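(* The model structures $\mathcal{L}_{H\mathbb{Q}}\mathcal{T}\mathrm{op}$ and $\mathcal{L}_{\mathbb{Q}}\mathcal{T}\mathrm{op}$ on the category of topological spaces are not equal.
   Context: Both model structures have as cofibrations the retracts of generalized relative CW inclusions, i.e. of maps $X_0\to\operatorname{colim}X_n$ for sequences of inclusions $X_0\to X_1\to\cdots$ with each $(X_{n+1},X_n)$ a relative CW complex. In $\mathcal{L}_{H\mathbb{Q}}\mathcal{T}\mathrm{op}$ (Bousfield's localization with respect to rational homology) the weak equivalences are the rational homology isomorphisms, i.e. maps $f$ such that $H_n(f;\mathbb{Q})$ is an isomorphism for all $n\ge0$. In $\mathcal{L}_{\mathbb{Q}}\mathcal{T}\mathrm{op}$ the weak equivalences are the rational homotopy equivalences, i.e. maps $f\colon X\to Y$ that induce isomorphisms $\pi_n(X)\to\pi_n(Y)$ for $n\le1$ (a bijection for $n=0$) and isomorphisms $\pi_n(X)\otimes\mathbb{Q}\to\pi_n(Y)\otimes\mathbb{Q}$ for $n\ge2$, at all basepoints. Both model structures are known to exist. *)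

(* Defs.v *)
From HB Require Import structures.
From mathcomp Require Import all_boot all_order all_algebra.
From mathcomp Require Import generic_quotient ring_quotient.
From mathcomp Require Import freeg.
From mathcomp Require Import all_classical all_reals topology normedtype.
Import numFieldNormedType.Exports.

Set Implicit Arguments.
Unset Strict Implicit.
Unset Printing Implicit Defensive.

Import Order.TTheory GRing.Theory Num.Theory.

Local Open Scope classical_set_scope.
Local Open Scope ring_scope.
Local Open Scope quotient_scope.

(* Objects are all (not necessarily pointed or separated) topological spaces,
   morphisms are bundled continuous maps; two of them are equal iff they agree
   pointwise ([continuousEP]). *)
Definition map_class := forall X Y : topologicalType, continuousType X Y -> Prop.

Definition comp_cts (X Y Z : topologicalType) (g : continuousType Y Z)
  (f : continuousType X Y) : continuousType X Z := g \o f.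

Definition has_lifting (A B X Y : topologicalType)
    (i : continuousType A B) (p : continuousType X Y) : Prop :=
  forall (u : continuousType A X) (v : continuousType B Y),
    p \o u =1 v \o i ->
    exists h : continuousType B X, h \o i =1 u /\ p \o h =1 v.

Definition retract_of (A B X Y : topologicalType)
    (f : continuousType A B) (g : continuousType X Y) : Prop :=
  exists (i : continuousType A X) (r : continuousType X A)
         (j : continuousType B Y) (s : continuousType Y B),
    [/\ r \o i =1 id, s \o j =1 id, g \o i =1 j \o f & f \o r =1 s \o g].

Definition retracts (C : map_class) : map_class := fun A B f =>
  exists (X Y : topologicalType) (g : continuousType X Y),
    C X Y g /\ retract_of f g.

Definition retract_closed (C : map_class) : Prop :=
  forall (A B : topologicalType) (f : continuousType A B),
    retracts C f -> C A B f.

Definition two_of_three (W : map_class) : Prop :=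
  forall (X Y Z : topologicalType)
         (f : continuousType X Y) (g : continuousType Y Z),
    [/\ W _ _ f -> W _ _ g -> W _ _ (comp_cts g f),
        W _ _ f -> W _ _ (comp_cts g f) -> W _ _ g
      & W _ _ g -> W _ _ (comp_cts g f) -> W _ _ f].

Definition class_lifting (L R : map_class) : Prop :=
  forall (A B X Y : topologicalType)
         (i : continuousType A B) (p : continuousType X Y),
    L _ _ i -> R _ _ p -> has_lifting i p.

Definition class_factorization (L R : map_class) : Prop :=
  forall (X Y : topologicalType) (f : continuousType X Y),
    exists (Z : topologicalType) (i : continuousType X Z)
           (p : continuousType Z Y),
      [/\ L _ _ i, R _ _ p & f =1 p \o i].

Definition classI (C D : map_class) : map_class := fun X Y f => C X Y f /\ D X Y f.

Record model_structure := ModelStructure {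
  weak_equiv : map_class;
  cofibration : map_class;
  fibration : map_class;
  weak_equiv_two_of_three : two_of_three weak_equiv;
  weak_equiv_retract : retract_closed weak_equiv;
  cofibration_retract : retract_closed cofibration;
  fibration_retract : retract_closed fibration;
  lifting_acyclic_cof : class_lifting (classI cofibration weak_equiv) fibration;
  lifting_acyclic_fib : class_lifting cofibration (classI fibration weak_equiv);
  factor_acyclic_cof :
    class_factorization (classI cofibration weak_equiv) fibration;
  factor_acyclic_fib :
    class_factorization cofibration (classI fibration weak_equiv)
}.

(* [c] exhibits [B] as the colimit of [X 0 -> X 1 -> ...] in topological
   spaces. *)
Definition is_seq_colimit (X : nat -> topologicalType)
    (s : forall n, continuousType (X n) (X n.+1)) (B : topologicalType)
    (c : forall n, continuousType (X n) B) : Prop :=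
  (forall n, c n.+1 \o s n =1 c n) /\
  forall (Z : topologicalType) (z : forall n, continuousType (X n) Z),
    (forall n, z n.+1 \o s n =1 z n) ->
    exists! h : continuousType B Z, forall n, h \o c n =1 z n.

(* Sequential composites A -> X 0 -> X 1 -> ... -> B = colim X, where A -> X 0
   lies in [P 0] and X n -> X n.+1 lies in [P n.+1]. *)
Definition seq_composite (P : nat -> map_class) : map_class := fun A B f =>
  exists (X : nat -> topologicalType) (e : continuousType A (X 0%N))
         (s : forall n, continuousType (X n) (X n.+1))
         (c : forall n, continuousType (X n) B),
    [/\ P 0%N _ _ e, forall n, P n.+1 _ _ (s n), is_seq_colimit s c
      & f =1 c 0%N \o e].

Lemma cts_comp (T U V : topologicalType) (f : T -> U) (g : U -> V) :
  continuous f -> continuous g -> continuous (fun t => g (f t)).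
Proof. by move=> cf cg t; exact: (continuous_comp (cf t) (cg (f t))). Qed.

Lemma cts_pair (T U V : topologicalType) (f : T -> U) (g : T -> V) :
  continuous f -> continuous g -> continuous (fun t => (f t, g t)).
Proof. by move=> cf cg t; apply: cvg_pair; [exact: cf|exact: cg]. Qed.

Lemma cts_fst (T U : topologicalType) : continuous (@fst T U).
Proof. by move=> p; exact: cvg_fst. Qed.

Lemma cts_snd (T U : topologicalType) : continuous (@snd T U).
Proof. by move=> p; exact: cvg_snd. Qed.

Lemma cts_set_val (U : topologicalType) (A : set U) :
  continuous (set_val : set_type A -> U).
Proof. exact: initial_continuous. Qed.

Definition subgroup_gen (V : zmodType) (S : set V) : {pred V} :=
  [pred v | `[< forall H : {pred V},
                  zmod_closed H -> (forall s, S s -> s \in H) -> v \in H >]].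

Lemma subgroup_gen_zmod_closed (V : zmodType) (S : set V) :
  zmod_closed (subgroup_gen S).
Proof.
split=> [|u v /asboolP Su /asboolP Sv]; apply/asboolP => H HC SH.
  exact: HC.1.
by apply: HC.2; [exact: Su|exact: Sv].
Qed.

HB.instance Definition _ (V : zmodType) (S : set V) :=
  GRing.isZmodClosed.Build V (subgroup_gen S) (subgroup_gen_zmod_closed S).

Lemma fglift_linear (S : nzRingType) (K : choiceType) (M : lmodType S)
  (h : K -> M) : linear (fglift h).
Proof.
have h0 : fglift h 0 = 0 by rewrite -(subrr 0) lift_is_additive subrr.
have hN d : fglift h (- d) = - fglift h d.
  by rewrite -sub0r lift_is_additive h0 sub0r.
have hD c d : fglift h (c + d) = fglift h c + fglift h d.
  by rewrite -{1}[d]opprK lift_is_additive hN opprK.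
have UE k x : << k *g x >> = k *: << x >> :> {freeg K / S}.
  by apply/eqP/freeg_eqP => y; rewrite coeffZ !coeffU mul1r.
have hZ k c : fglift h (k *: c) = k *: fglift h c.
  elim/freeg_ind_dom0: c => [|l x c _ _ IH]; first by rewrite scaler0 h0 scaler0.
  by rewrite scalerDr !hD IH UE scalerA -!UE !liftU scalerDr scalerA.
by move=> k c d; rewrite hD hZ.
Qed.

Section TensorQ.
Variables (A : choiceType) (addA : A -> A -> A).

(* A (x) Q for an abelian group [A] with addition [addA]: the free abelian group
   on A x Q modulo bilinearity. *)
Definition tensorQ_rel : set {freeg (A * rat)%type / int} :=
  [set z | (exists a b q,
              z = << (addA a b, q) >> - << (a, q) >> - << (b, q) >>) \/
           (exists a q r,
              z = << (a, q + r) >> - << (a, q) >> - << (a, r) >>)].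

Definition tensorQ : zmodType :=
  Quotient.quot (subgroup_gen tensorQ_rel : zmodClosed _).

End TensorQ.

Definition freeg_map (A B : choiceType) (h : A -> B)
    (z : {freeg (A * rat)%type / int}) : {freeg (B * rat)%type / int} :=
  fglift (fun p => << (h p.1, p.2) >>) z.

Definition tensorQ_map (A B : choiceType) (addA : A -> A -> A)
    (addB : B -> B -> B) (h : A -> B) (z : tensorQ addA) : tensorQ addB :=
  \pi_(tensorQ addB) (freeg_map h (repr z)).
Arguments tensorQ_map {A B} addA addB h z.

HB.instance Definition _ (A B : choiceType) (h : A -> B) :=
  GRing.isLinear.Build int {freeg (A * rat)%type / int}
    {freeg (B * rat)%type / int} _ (freeg_map h) (@fglift_linear _ _ _ _).

Lemma tensorQ_map_pi (A B : choiceType) (addA : A -> A -> A)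
    (addB : B -> B -> B) (h : A -> B) (z : {freeg (A * rat)%type / int}) :
  {morph h : a b / addA a b >-> addB a b} ->
  tensorQ_map addA addB h (\pi z) = \pi_(tensorQ addB) (freeg_map h z).
Proof.
move=> hD; apply/eqP; rewrite /tensorQ_map -Quotient.idealrBE -linearB/=.
have /asboolP zA : repr (\pi_(tensorQ addA) z) - z
    \in subgroup_gen (tensorQ_rel addA) by rewrite Quotient.idealrBE reprK.
have hU p : freeg_map h << p >> = << (h p.1, p.2) >>.
  by rewrite /freeg_map liftU scale1r.
apply: (zA (fun v => freeg_map h v \in subgroup_gen (tensorQ_rel addB))).
  split=> [|u v]; rewrite -!topredE /=; first by rewrite linear0 rpred0.
  by move=> Su Sv; rewrite linearB; exact: rpredB.
move=> v Sv; rewrite -topredE /=; apply/asboolP => H _; apply.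
case: Sv => -[a [b [q ->]]]; rewrite !linearB/= !hU/= ?hD.
  by left; exists (h a), (h b), q.
by right; exists (h a), b, q.
Qed.

Section Real.
Variable R : realType.

Definition disk_set (n : nat) : set 'rV[R]_n :=
  [set x | \sum_i x ord0 i ^+ 2 <= 1].
Definition disk (n : nat) : Type := set_type (@disk_set n).
HB.instance Definition _ n := Topological.on (disk n).

(* Points of the boundary sphere S^(n-1) of the n-disk; there are none for
   n = 0. *)
Definition sphere_set (n : nat) : set (disk n) :=
  [set x : disk n | \sum_i (set_val x) ord0 i ^+ 2 = 1].
Definition sphere (n : nat) : Type := set_type (@sphere_set n).
HB.instance Definition _ n := Topological.on (sphere n).

(* [i] exhibits [X] as [A] with a family of n-cells attached: the pushout of
   [A] and J x D^n along J x S^(n-1).  The universal property of the coproducts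
   over J is spelled out. *)
Definition attaches_cells (n : nat) : map_class := fun A X i =>
  exists (J : Type) (phi : J -> continuousType (sphere n) A)
         (Phi : J -> continuousType (disk n) X),
    (forall j, Phi j \o set_val =1 i \o phi j) /\
    forall (Z : topologicalType) (a : continuousType A Z)
           (b : J -> continuousType (disk n) Z),
      (forall j, b j \o set_val =1 a \o phi j) ->
      exists! h : continuousType X Z,
        h \o i =1 a /\ forall j, h \o Phi j =1 b j.

Definition relative_CW : map_class := seq_composite attaches_cells.

Definition gen_relative_CW : map_class := seq_composite (fun=> relative_CW).

Definition simplex_set (n : nat) : set 'rV[R]_n.+1 :=
  [set x | (forall i, 0 <= x ord0 i) /\ \sum_i x ord0 i = 1].
Definition simplex (n : nat) : Type := set_type (@simplex_set n).
HB.instance Definition _ n := Topological.on (simplex n).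

Lemma continuous_mx (T U : topologicalType) m n (f : T -> 'M[U]_(m, n)) :
  (forall i j, continuous (fun t => f t i j)) -> continuous f.
Proof.
move=> cf t A [P fP sPA]; rewrite nbhs_simpl/=.
have rowP i : \forall x \near t, forall j, P i j (f x i j).
  by apply: filter_forall => j; exact: (cf i j t _ (fP i j)).
have : \forall x \near t, forall i j, P i j (f x i j) by exact: filter_forall.
by apply: filterS => x Px; exact: sPA.
Qed.

Lemma continuous_coord (U : topologicalType) m n i j :
  continuous (fun M : 'M[U]_(m, n) => M i j).
Proof.
move=> M A MA; rewrite nbhs_simpl/=.
exists (fun i' j' => [set u | i' = i -> j' = j -> A u]).
  move=> i' j'.
  have [->|/eqP ni] := eqVneq i' i; last by apply: nearW => u /ni.
  have [->|/eqP nj] := eqVneq j' j; last by apply: nearW => u _ /nj.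
  by apply: (@filterS _ _ _ A) => [u Au|] ; last exact: MA.
by move=> N /(_ i j); exact.
Qed.

Lemma continuous_set_val (T U : topologicalType) (A : set U) (f : T -> A) :
  continuous (fun t => set_val (f t)) -> continuous f.
Proof. by move=> cf; exact: (@continuous_comp_initial _ _ _ set_val). Qed.

(* Insertion of a zero barycentric coordinate at position [i]. *)
Definition face_row (n : nat) (i : 'I_n.+2) (x : 'rV[R]_n.+1) : 'rV[R]_n.+2 :=
  \row_j oapp (x ord0) 0 (unlift i j).

Lemma face_subproof n (i : 'I_n.+2) (x : simplex n) :
  face_row i (set_val x) \in @simplex_set n.+1.
Proof.
have [x_ge0 x_sum] := set_valP x; apply/mem_set; split.
  by move=> j; rewrite mxE; case: unliftP => /=.
rewrite (bigD1 i) //= mxE unlift_none add0r -x_sum.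
rewrite (reindex_omap (fintype.lift i) (unlift i)); last first.
  by move=> j; case: unliftP => [k ->//|->]; rewrite eqxx.
apply: eq_big => [k|k _]; last by rewrite mxE liftK.
by rewrite eq_sym neq_lift liftK eqxx.
Qed.

Definition face_fun n (i : 'I_n.+2) (x : simplex n) : simplex n.+1 :=
  SigSub (face_subproof i x).

Lemma face_continuous n (i : 'I_n.+2) : continuous (face_fun i).
Proof.
apply: (@continuous_set_val _ _ (@simplex_set n.+1)); apply: continuous_mx => k j /=.
under eq_fun do rewrite mxE.
case: unliftP => [l _|_]; last exact: (@cst_continuous (simplex n) R 0).
move=> x; apply: (@continuous_comp _ _ _ set_val (fun v : 'rV[R]_n.+1 => v ord0 l)).
  exact: (@initial_continuous _ _ set_val).
exact: continuous_coord.
Qed.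

HB.instance Definition _ n (i : 'I_n.+2) :=
  isContinuous.Build _ _ (face_fun i) (@face_continuous n i).

Definition face n (i : 'I_n.+2) : continuousType (simplex n) (simplex n.+1) :=
  face_fun i.

Definition chain (n : nat) (X : topologicalType) : lmodType rat :=
  {freeg (continuousType (simplex n) X) / rat}.

Definition boundary n X : chain n.+1 X -> chain n X :=
  fglift (fun sigma => \sum_(i < n.+2) (-1) ^+ i *: << comp_cts sigma (face i) >>).

Definition is_cycle n X : chain n X -> Prop :=
  match n return chain n X -> Prop with
  | 0 => fun=> True
  | m.+1 => fun z => boundary z = 0
  end.

Definition boundaries n X : {pred (chain n X)} :=
  [pred z | `[< exists c : chain n.+1 X, boundary c = z >]].

Lemma boundaryB n X : {morph @boundary n X : c d / c - d}.
Proof. exact: lift_is_additive. Qed.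

Lemma boundaries_zmod_closed n X : zmod_closed (@boundaries n X).
Proof.
split=> [|_ _ /asboolP[c <-] /asboolP[d <-]]; apply/asboolP.
  by exists 0; rewrite -(subrr 0) boundaryB subrr.
by exists (c - d); rewrite boundaryB.
Qed.

HB.instance Definition _ n X :=
  GRing.isZmodClosed.Build _ (@boundaries n X) (@boundaries_zmod_closed n X).

(* H_n(X; Q) = Z_n / B_n, as the subset of C_n / B_n of classes of cycles.  The
   map induced by [f] acts on representatives, see [homology_map_pi]. *)
Definition chain_mod_boundaries n X : zmodType :=
  Quotient.quot (@boundaries n X : zmodClosed (chain n X)).

Definition homology n X : set (chain_mod_boundaries n X) :=
  [set h | exists2 z : chain n X,
             is_cycle z & h = \pi_(chain_mod_boundaries n X) z].

Definition chain_map n (X Y : topologicalType) (f : continuousType X Y) :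
    chain n X -> chain n Y :=
  fglift (fun sigma => << comp_cts f sigma >>).

Lemma boundaryU n (X : topologicalType) (sigma : continuousType (simplex n.+1) X) :
  boundary << sigma >> =
  \sum_(i < n.+2) (-1) ^+ i *: << comp_cts sigma (face i) >> :> chain n X.
Proof. by rewrite /boundary liftU scale1r. Qed.

Lemma chain_mapU n (X Y : topologicalType) (f : continuousType X Y)
    (sigma : continuousType (simplex n) X) :
  chain_map f << sigma >> = << comp_cts f sigma >>.
Proof. by rewrite /chain_map liftU scale1r. Qed.

HB.instance Definition _ n X := GRing.isLinear.Build rat (chain n.+1 X)
  (chain n X) _ (@boundary n X) (@fglift_linear _ _ _ _).
HB.instance Definition _ n (X Y : topologicalType) (f : continuousType X Y) :=
  GRing.isLinear.Build rat (chain n X) (chain n Y) _ (@chain_map n X Y f)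
    (@fglift_linear _ _ _ _).

Lemma chain_ind n (X : topologicalType) (P : chain n X -> Prop) :
  P 0 -> (forall k sigma c, P c -> P (k *: << sigma >> + c)) -> forall c, P c.
Proof.
move=> P0 PD; elim/freeg_ind_dom0 => // k sigma c _ _ Pc.
rewrite (_ : << k *g sigma >> = k *: << sigma >>); first exact: PD.
by apply/eqP/freeg_eqP => y; rewrite coeffZ !coeffU mul1r.
Qed.

Lemma chain_map_boundary n (X Y : topologicalType) (f : continuousType X Y)
    (c : chain n.+1 X) :
  boundary (chain_map f c) = chain_map f (boundary c).
Proof.
elim/chain_ind: c => [|k sigma c IH]; first by rewrite !linear0.
rewrite !linearP/= IH chain_mapU !boundaryU; congr (_ *: _ + _).
rewrite linear_sum.
apply: eq_bigr => i _; rewrite linearZ/= chain_mapU; congr (_ *: << _ >>).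
exact/continuousEP.
Qed.

Definition homology_map n (X Y : topologicalType) (f : continuousType X Y)
    (h : chain_mod_boundaries n X) : chain_mod_boundaries n Y :=
  \pi_(chain_mod_boundaries n Y) (chain_map f (repr h)).

Lemma homology_map_pi n (X Y : topologicalType) (f : continuousType X Y)
    (z : chain n X) :
  homology_map f (\pi z) = \pi_(chain_mod_boundaries n Y) (chain_map f z).
Proof.
apply/eqP; rewrite /homology_map -Quotient.idealrBE -linearB/=.
have /asboolP[c cE] : repr (\pi_(chain_mod_boundaries n X) z) - z
    \in @boundaries n X by rewrite Quotient.idealrBE reprK.
by apply/asboolP; exists (chain_map f c); rewrite chain_map_boundary cE.
Qed.

Definition rational_homology_iso : map_class := fun X Y f =>
  forall n, set_bij (@homology n X) (@homology n Y) (@homology_map n X Y f).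


(* [clamp 0] and [clamp 1] are the endpoints of the unit interval. *)
Definition unit_interval : Type := set_type `[0 : R, 1].
HB.instance Definition _ := Topological.on unit_interval.

Lemma clamp_subproof (r : R) : Num.max 0 (Num.min 1 r) \in `[0 : R, 1]%classic.
Proof. by apply/mem_set; rewrite /= in_itv /= le_max lexx /= ge_max ler01 ge_min lexx. Qed.

Definition clamp (r : R) : unit_interval := SigSub (clamp_subproof r).

Lemma clamp_continuous : continuous clamp.
Proof.
apply: (@continuous_set_val _ _ `[0 : R, 1]%classic) => r /=.
apply: continuous_max; first exact: cvg_cst.
by apply: continuous_min; [exact: cvg_cst|exact: cvg_id].
Qed.

Lemma set_val_clamp (r : R) : set_val (clamp r) = Num.max 0 (Num.min 1 r).
Proof. by []. Qed.

Lemma clampE (r : R) : 0 <= r <= 1 -> set_val (clamp r) = r.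
Proof. by move=> /andP[r0 r1]; rewrite set_val_clamp min_r // max_r. Qed.

Lemma glue_continuous (T X : topologicalType) (c : T -> R) (f g : T -> X) :
  continuous c -> continuous f -> continuous g ->
  (forall t, c t = 2^-1 -> f t = g t) ->
  continuous (fun t => if c t <= 2^-1 then f t else g t).
Proof.
move=> cc cf cg fg; apply/continuous_subspace_setT.
have -> : [set: T] = [set t | c t <= 2^-1] `|` [set t | 2^-1 <= c t].
  by apply/esym/seteqP; split=> // t _ /=; apply/orP; exact: le_total.
apply: withinU_continuous.
- by apply: (closed_comp _ (@closed_le R 2^-1)) => t _; exact: cc.
- by apply: (closed_comp _ (@closed_ge R 2^-1)) => t _; exact: cc.
- apply: (@subspace_eq_continuous _ _ _ f); last exact: continuous_subspaceT.
  by move=> t /set_mem ct; rewrite /from_subspace/= ifT.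
- apply: (@subspace_eq_continuous _ _ _ g); last exact: continuous_subspaceT.
  move=> t /set_mem ct; rewrite /from_subspace/=; case: ifP => // ct'; apply/esym/fg.
  by apply/eqP; rewrite eq_le ct ct'.
Qed.

Definition affine (a b : R) (s : unit_interval) : unit_interval :=
  clamp (a * set_val s + b).

Lemma affine_continuous a b : continuous (affine a b).
Proof.
have cab : continuous (fun r : R => a * r + b).
  by move=> r; apply: cvgD; [apply: cvgMl_tmp; exact: cvg_id|exact: cvg_cst].
exact: (cts_comp (@cts_set_val _ `[0 : R, 1]%classic)
                 (cts_comp cab clamp_continuous)).
Qed.

Lemma affine0 a b : affine a b (clamp 0) = clamp b.
Proof. by rewrite /affine clampE ?lexx ?ler01// mulr0 add0r. Qed.

Lemma affine1 a b : affine a b (clamp 1) = clamp (a + b).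
Proof. by rewrite /affine clampE ?lexx ?ler01// mulr1. Qed.

Lemma affine_2N1 : affine 2 (- 1) (clamp 1) = clamp 1.
Proof. by rewrite affine1 -[2]/(1 + 1) addrK. Qed.

Lemma clamp0_le : set_val (clamp 0) <= 2^-1 :> R.
Proof. by rewrite clampE ?lexx ?ler01// invr_ge0 ler0n. Qed.

Lemma clamp1_gt : (set_val (clamp 1) <= 2^-1 :> R) = false.
Proof.
by apply/negbTE; rewrite clampE ?lexx ?ler01// -ltNge invf_lt1 ?ltr1n ?ltr0n.
Qed.

Section PathComponents.
Variable X : topologicalType.

Definition path_rel : rel X := fun x y =>
  `[< exists g : continuousType unit_interval X,
        g (clamp 0) = x /\ g (clamp 1) = y >].

Lemma path_rel_refl : reflexive path_rel.
Proof. by move=> x; apply/asboolP; exists (cst x). Qed.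

Lemma path_rel_sym : symmetric path_rel.
Proof.
suff sub x y : path_rel x y -> path_rel y x by move=> x y; apply/idP/idP; exact: sub.
move=> /asboolP[g [g0 g1]]; apply/asboolP.
have cg : continuous (g \o affine (- 1) 1).
  exact: (cts_comp (@affine_continuous (- 1) 1) (@cts_fun _ _ g)).
exists (mkcts cg); split; first by rewrite -g1 -[in RHS](affine0 (- 1) 1).
by rewrite -g0 -[in RHS](addNr 1) -affine1.
Qed.

Lemma path_rel_trans : transitive path_rel.
Proof.
move=> y x z /asboolP[g [g0 g1]] /asboolP[h [h0 h1]]; apply/asboolP.
have cgh : continuous (fun s : unit_interval => if set_val s <= 2^-1
    then g (affine 2 0 s) else h (affine 2 (- 1) s)).
  apply: glue_continuous.
  - exact: cts_set_val.
  - exact: (cts_comp (@affine_continuous 2 0) (@cts_fun _ _ g)).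
  - exact: (cts_comp (@affine_continuous 2 (- 1)) (@cts_fun _ _ h)).
  - move=> s sE; rewrite /affine sE divff ?pnatr_eq0// addr0 subrr.
    by rewrite g1 h0.
exists (mkcts cgh); split.
  by rewrite -g0 -[in RHS](affine0 2 0); exact: ifT clamp0_le.
by rewrite -h1 -[in RHS]affine_2N1; exact: ifF clamp1_gt.
Qed.

Canonical path_rel_equiv :=
  EquivRel path_rel path_rel_refl path_rel_sym path_rel_trans.

(* No basepoint is involved, so that empty spaces are covered. *)
Definition pi0 : choiceType := {eq_quot path_rel}.

End PathComponents.

Definition pi0_map (X Y : topologicalType) (f : continuousType X Y)
  (a : pi0 X) : pi0 Y := \pi_(pi0 Y) (f (repr a)).

Definition cube (n : nat) : Type := 'rV[unit_interval]_n.
HB.instance Definition _ n := Topological.on (cube n).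

Definition cube_boundary (n : nat) : set (cube n) :=
  [set t | exists i, set_val (t ord0 i) = 0 \/ set_val (t ord0 i) = 1].

Definition loop (n : nat) (X : topologicalType) (x : X) : Type :=
  set_type [set f : continuousType (cube n) X |
             forall t, cube_boundary t -> f t = x].
HB.instance Definition _ n (X : topologicalType) (x : X) := Choice.on (loop n x).

Definition loop_fun n (X : topologicalType) (x : X) (f : loop n x) :
  continuousType (cube n) X := val f.

Lemma loop_boundary n (X : topologicalType) (x : X) (f : loop n x) t :
  cube_boundary t -> loop_fun f t = x.
Proof. exact: (set_valP f). Qed.

Lemma mk_loop_subproof n (X : topologicalType) (x : X)
    (f : continuousType (cube n) X) :
  (forall t, cube_boundary t -> f t = x) ->
  f \in [set f : continuousType (cube n) X |
         forall t, cube_boundary t -> f t = x].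
Proof. by move=> fx; apply/mem_set. Qed.

Definition mk_loop n (X : topologicalType) (x : X)
    (f : continuousType (cube n) X)
    (fx : forall t, cube_boundary t -> f t = x) : loop n x :=
  SigSub (mk_loop_subproof fx).

Section HomotopyGroup.
Variables (n : nat) (X : topologicalType) (x : X).

Definition loop_rel : rel (loop n x) := fun f g =>
  `[< exists H : continuousType (cube n * unit_interval)%type X,
        [/\ forall t, H (t, clamp 0) = loop_fun f t,
            forall t, H (t, clamp 1) = loop_fun g t
          & forall t s, cube_boundary t -> H (t, s) = x] >].

Lemma affine_snd_continuous (a b : R) :
  continuous (fun p : cube n * unit_interval => (p.1, affine a b p.2)).
Proof.
apply: cts_pair; first exact: cts_fst.
exact: (cts_comp (@cts_snd _ _) (@affine_continuous a b)).
Qed.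

Lemma loop_rel_refl : reflexive loop_rel.
Proof.
move=> f; apply/asboolP.
have cH : continuous (fun p : cube n * unit_interval => loop_fun f p.1).
  exact: (cts_comp (@cts_fst _ _) (@cts_fun _ _ (loop_fun f))).
exists (mkcts cH); split=> // t s; exact: loop_boundary.
Qed.

Lemma loop_rel_sym : symmetric loop_rel.
Proof.
suff sub f g : loop_rel f g -> loop_rel g f.
  by move=> f g; apply/idP/idP; exact: sub.
move=> /asboolP[H [H0 H1 Hx]]; apply/asboolP.
have cH : continuous (fun p : cube n * unit_interval => H (p.1, affine (- 1) 1 p.2)).
  exact: (cts_comp (@affine_snd_continuous (- 1) 1) (@cts_fun _ _ H)).
exists (mkcts cH); split=> [t|t|t s bt].
- by rewrite -H1 -[in RHS](affine0 (- 1) 1).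
- by rewrite -H0 -[in RHS](addNr 1) -affine1.
- exact: Hx.
Qed.

Lemma loop_rel_trans : transitive loop_rel.
Proof.
move=> g f h /asboolP[H [H0 H1 Hx]] /asboolP[K [K0 K1 Kx]]; apply/asboolP.
have cHK : continuous (fun p : cube n * unit_interval => if set_val p.2 <= 2^-1
    then H (p.1, affine 2 0 p.2) else K (p.1, affine 2 (- 1) p.2)).
  apply: glue_continuous.
  - exact: (cts_comp (@cts_snd _ _) (@cts_set_val _ `[0 : R, 1]%classic)).
  - exact: (cts_comp (@affine_snd_continuous 2 0) (@cts_fun _ _ H)).
  - exact: (cts_comp (@affine_snd_continuous 2 (- 1)) (@cts_fun _ _ K)).
  - move=> p pE; rewrite /affine pE divff ?pnatr_eq0// addr0 subrr.
    by rewrite H1 K0.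
exists (mkcts cHK); split=> [t|t|t s bt].
- transitivity (H (t, affine 2 0 (clamp 0))); first exact: ifT clamp0_le.
  by rewrite affine0 H0.
- transitivity (K (t, affine 2 (- 1) (clamp 1))); first exact: ifF clamp1_gt.
  by rewrite affine_2N1 K1.
- change ((if set_val s <= 2^-1 then H (t, affine 2 0 s)
           else K (t, affine 2 (- 1) s)) = x).
  by case: ifP => _; [exact: Hx|exact: Kx].
Qed.

Canonical loop_rel_equiv :=
  EquivRel loop_rel loop_rel_refl loop_rel_sym loop_rel_trans.

Definition homotopy_group : choiceType := {eq_quot loop_rel}.

End HomotopyGroup.

Lemma comp_loop_boundary n (X Y : topologicalType) (x : X)
    (f : continuousType X Y) (a : loop n x) t :
  cube_boundary t -> comp_cts f (loop_fun a) t = f x.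
Proof. by move=> bt; rewrite /comp_cts/= loop_boundary. Qed.

Definition loop_map n (X Y : topologicalType) (x : X) (f : continuousType X Y)
  (a : loop n x) : loop n (f x) := mk_loop (comp_loop_boundary f a).

Definition pi_map n (X Y : topologicalType) (f : continuousType X Y) (x : X)
  (a : homotopy_group n x) : homotopy_group n (f x) :=
  \pi_(homotopy_group n (f x)) (loop_map f (repr a)).

Definition reparam n (r : unit_interval -> unit_interval) (t : cube n.+1) :
    cube n.+1 :=
  \row_j (if j == ord0 then r (t ord0 j) else t ord0 j).

Lemma reparam_continuous n (r : unit_interval -> unit_interval) :
  continuous r -> continuous (@reparam n r).
Proof.
move=> cr; apply: continuous_mx => i j.
under eq_fun do rewrite mxE.
case: (j == ord0); last exact: continuous_coord.
exact: (cts_comp (@continuous_coord _ _ _ ord0 j) cr).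
Qed.

Lemma reparam_boundaryl n (t : cube n.+1) : cube_boundary t ->
  set_val (t ord0 ord0) <= 2^-1 -> cube_boundary (reparam (affine 2 0) t).
Proof.
move=> [i ti] t0; exists i; rewrite mxE; case: eqP => // i0; left.
rewrite -i0 in t0; case: ti => ti; rewrite ti in t0.
  by rewrite /affine ti mulr0 addr0 clampE ?lexx ?ler01.
by rewrite leNgt invf_lt1 ?ltr1n ?ltr0n in t0.
Qed.

Lemma reparam_boundaryr n (t : cube n.+1) : cube_boundary t ->
  (set_val (t ord0 ord0) <= 2^-1) = false ->
  cube_boundary (reparam (affine 2 (- 1)) t).
Proof.
move=> [i ti] t0; exists i; rewrite mxE; case: eqP => // i0; right.
rewrite -i0 in t0; case: ti => ti; rewrite ti in t0.
  by rewrite invr_ge0 ler0n in t0.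
by rewrite /affine ti mulr1 -[2]/(1 + 1) addrK clampE ?lexx ?ler01.
Qed.

Definition concat_fun n (X : topologicalType) (x : X) (f g : loop n.+1 x)
    (t : cube n.+1) : X :=
  if set_val (t ord0 ord0) <= 2^-1
  then loop_fun f (reparam (affine 2 0) t)
  else loop_fun g (reparam (affine 2 (- 1)) t).

Lemma concat_continuous n (X : topologicalType) (x : X) (f g : loop n.+1 x) :
  continuous (concat_fun f g).
Proof.
have cf (h : loop n.+1 x) a b :
    continuous (fun t => loop_fun h (reparam (affine a b) t)).
  apply: (cts_comp _ (@cts_fun _ _ (loop_fun h))).
  exact/reparam_continuous/affine_continuous.
apply: glue_continuous => //.
  exact: (cts_comp (@continuous_coord _ _ _ ord0 ord0)
                   (@cts_set_val _ `[0 : R, 1]%classic)).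
move=> t tE; rewrite !loop_boundary//; exists ord0; rewrite mxE eqxx /affine tE.
  by left; rewrite divff ?pnatr_eq0// subrr clampE ?lexx ?ler01.
by right; rewrite divff ?pnatr_eq0// addr0 clampE ?lexx ?ler01.
Qed.

Lemma concat_boundary n (X : topologicalType) (x : X) (f g : loop n.+1 x) t :
  cube_boundary t -> mkcts (@concat_continuous _ _ _ f g) t = x.
Proof.
move=> bt; change (concat_fun f g t = x); rewrite /concat_fun.
by case: ifP => t0; apply: loop_boundary;
  [exact: reparam_boundaryl|exact: reparam_boundaryr].
Qed.

Definition concat n (X : topologicalType) (x : X) (f g : loop n.+1 x) :
  loop n.+1 x := mk_loop (concat_boundary f g).

Definition pi_add n (X : topologicalType) (x : X)
    (a b : homotopy_group n.+1 x) : homotopy_group n.+1 x :=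
  \pi_(homotopy_group n.+1 x) (concat (repr a) (repr b)).

Lemma pi0_map_pi (X Y : topologicalType) (f : continuousType X Y) (x : X) :
  pi0_map f (\pi x) = \pi_(pi0 Y) (f x).
Proof.
apply/eqmodP; have /eqmodP/asboolP[g [g0 g1]] := reprK (\pi_(pi0 X) x).
apply/asboolP; exists (comp_cts f g).
by rewrite /comp_cts/= g0 g1.
Qed.

Lemma pi_map_pi n (X Y : topologicalType) (f : continuousType X Y) (x : X)
    (a : loop n x) :
  pi_map f (\pi a) = \pi_(homotopy_group n (f x)) (loop_map f a).
Proof.
apply/eqmodP; have /eqmodP/asboolP[H [H0 H1 Hx]] :=
  reprK (\pi_(homotopy_group n x) a).
apply/asboolP; exists (comp_cts f H); split=> [t|t|t s bt].
- exact: congr1 (H0 t).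
- exact: congr1 (H1 t).
- exact: congr1 (Hx t s bt).
Qed.

Lemma pi_add_pi n (X : topologicalType) (x : X) (a b : loop n.+1 x) :
  pi_add (\pi a) (\pi b) = \pi_(homotopy_group n.+1 x) (concat a b).
Proof.
apply/eqmodP; have /eqmodP/asboolP[H [H0 H1 Hx]] :=
  reprK (\pi_(homotopy_group n.+1 x) a).
have /eqmodP/asboolP[K [K0 K1 Kx]] := reprK (\pi_(homotopy_group n.+1 x) b).
apply/asboolP.
have cr (p q : R) : continuous
    (fun ts : cube n.+1 * unit_interval => (reparam (affine p q) ts.1, ts.2)).
  apply: cts_pair; last exact: cts_snd.
  exact: (cts_comp (@cts_fst _ _) (reparam_continuous (@affine_continuous p q))).
have cHK : continuous (fun ts : cube n.+1 * unit_interval =>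
    if set_val (ts.1 ord0 ord0) <= 2^-1
    then H (reparam (affine 2 0) ts.1, ts.2)
    else K (reparam (affine 2 (- 1)) ts.1, ts.2)).
  apply: glue_continuous.
  - exact: (cts_comp (cts_comp (@cts_fst _ _) (@continuous_coord _ _ _ ord0 ord0))
      (@cts_set_val _ `[0 : R, 1]%classic)).
  - exact: (cts_comp (cr 2 0) (@cts_fun _ _ H)).
  - exact: (cts_comp (cr 2 (- 1)) (@cts_fun _ _ K)).
  - move=> [t s] /= tE; rewrite Hx ?Kx//; exists ord0; rewrite mxE eqxx /affine tE.
      by left; rewrite divff ?pnatr_eq0// subrr clampE ?lexx ?ler01.
    by right; rewrite divff ?pnatr_eq0// addr0 clampE ?lexx ?ler01.
exists (mkcts cHK); split=> [t|t|t s bt].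
- change ((if set_val (t ord0 ord0) <= 2^-1
    then H (reparam (affine 2 0) t, clamp 0)
    else K (reparam (affine 2 (- 1)) t, clamp 0)) =
    concat_fun (repr (\pi_(homotopy_group n.+1 x) a))
               (repr (\pi_(homotopy_group n.+1 x) b)) t).
  by rewrite H0 K0.
- change ((if set_val (t ord0 ord0) <= 2^-1
    then H (reparam (affine 2 0) t, clamp 1)
    else K (reparam (affine 2 (- 1)) t, clamp 1)) = concat_fun a b t).
  by rewrite H1 K1.
- change ((if set_val (t ord0 ord0) <= 2^-1
    then H (reparam (affine 2 0) t, s)
    else K (reparam (affine 2 (- 1)) t, s)) = x).
  by case: ifP => t0; [apply/Hx/reparam_boundaryl|apply/Kx/reparam_boundaryr].
Qed.

Lemma loop_map_concat n (X Y : topologicalType) (x : X)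
    (f : continuousType X Y) (a b : loop n.+1 x) :
  loop_map f (concat a b) = concat (loop_map f a) (loop_map f b).
Proof.
apply/val_inj/continuousEP => t.
change (f (concat_fun a b t) = concat_fun (loop_map f a) (loop_map f b) t).
by rewrite /concat_fun; case: ifP.
Qed.

Lemma pi_mapD n (X Y : topologicalType) (f : continuousType X Y) (x : X)
    (a b : homotopy_group n.+1 x) :
  pi_map f (pi_add a b) = pi_add (pi_map f a) (pi_map f b).
Proof.
elim/quotW: a => a; elim/quotW: b => b.
by rewrite pi_add_pi !pi_map_pi pi_add_pi loop_map_concat.
Qed.

(* On homotopy groups: a bijection on path components and, at every basepoint,
   an isomorphism on pi_1 and on pi_n (x) Q for n >= 2.  The maps on pi_1 and
   pi_n are homomorphisms by [pi_mapD], so bijectivity is what is left. *)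
Definition rational_homotopy_equiv : map_class := fun X Y f =>
  bijective (@pi0_map X Y f) /\
  forall x : X,
    bijective (@pi_map 1 X Y f x) /\
    forall n, bijective (tensorQ_map (@pi_add n.+1 X x)
                                     (@pi_add n.+1 Y (f x))
                                     (@pi_map n.+2 X Y f x)).

(* A model structure is determined by its cofibrations and weak equivalences:
   the fibrations are the maps with the right lifting property against the
   acyclic cofibrations. *)
Definition is_LHQ_Top (M : model_structure) : Prop :=
  (forall (X Y : topologicalType) (f : continuousType X Y),
     cofibration M f <-> retracts gen_relative_CW f) /\
  (forall (X Y : topologicalType) (f : continuousType X Y),
     weak_equiv M f <-> rational_homology_iso f).

Definition is_LQ_Top (M : model_structure) : Prop :=
  (forall (X Y : topologicalType) (f : continuousType X Y),
     cofibration M f <-> retracts gen_relative_CW f) /\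
  (forall (X Y : topologicalType) (f : continuousType X Y),
     weak_equiv M f <-> rational_homotopy_equiv f).

End Real.

(* Main.v *)
Require Import Defs.
From HB Require Import structures.
From mathcomp Require Import all_boot all_order all_algebra.
From mathcomp Require Import zify ring lra.
From mathcomp Require Import freeg generic_quotient ring_quotient.
From mathcomp Require Import all_classical all_reals topology normedtype.
From mathcomp Require Import realfun trigo.
Import numFieldNormedType.Exports.

(** A model structure determines its weak equivalences, so it is enough to
    exhibit one map which is a rational homology isomorphism but not a rational
    homotopy equivalence.  The map is the squaring map of the unit circle,
    z |-> z ^ 2, a connected double covering.

    On homology, a double covering has a transfer: [transfer] sends a singular
    simplex of the base to the sum of its two lifts.  It is a chain map; after
    composition with squaring on the left it is multiplication by 2
    ([transferK]), and on the right it is 1 + a, where a is induced by the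
    antipodal map z |-> - z ([transfer_squaring]).  Rotating the circle by half
    a turn is a homotopy from the identity to the antipodal map, so a is the
    identity on homology and both composites are multiplication by 2, which is
    invertible over the rationals: [squaring_homology_iso].  No homology group
    of the circle is computed.

    On the fundamental group, squaring is not surjective: the loop
    u |-> exp (2 i pi u) has the path u |-> exp (i pi u) as square root, and
    that path goes from 1 to - 1.  If the loop were homotopic to the square of a
    loop, carrying the square root along the homotopy would give it a closed
    square root as well; but square roots over an interval are unique up to
    sign: [squaring_not_homotopy_equiv].

    Both halves rest on the covering properties of squaring.  They come from an
    explicit formula rather than from local trivialisations: a unit complex
    number w other than - 1 has the square root (1 + w) / |1 + w|, continuous in
    w, so if g is a square root of f and f' is nowhere antipodal to f, then f'
    has the square root g * sqrt (f' / f) ([sqrt_close]).  Over a compact space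
    this carries square roots along homotopies ([sqrt_homotopy]), hence every
    map from a compact contractible space to the circle has one
    ([sqrt_exists]), unique up to sign ([sqrt_unique]).  Homotopy invariance of
    singular homology is obtained from the prism operator
    ([homotopic_cycles]). *)

Set Implicit Arguments.
Unset Strict Implicit.
Unset Printing Implicit Defensive.

Import Order.TTheory GRing.Theory Num.Theory.

Local Open Scope classical_set_scope.
Local Open Scope ring_scope.
Local Open Scope quotient_scope.

(** * Connectedness of the unit interval and compact subspaces *)

Section IntervalInduction.
Variable R : realType.

Lemma clampK (s : unit_interval R) : clamp (set_val s) = s.
Proof.
by apply: val_inj; have := set_valP s; rewrite /= in_itv; exact: clampE.
Qed.

(** Connectedness of the unit interval as an induction principle: a locally
    constant predicate is constant.  Square roots are both propagated along a
    homotopy and compared with one another in this way. *)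
Lemma unit_interval_ind (P : unit_interval R -> Prop) :
  (forall s0, \forall s \near s0, P s <-> P s0) ->
  P (clamp 0) -> forall s, P s.
Proof.
move=> Ploc P0.
have openP (Q : unit_interval R -> Prop) :
    (forall s0, \forall s \near s0, Q s <-> Q s0) ->
    open [set r : R | Q (clamp r)].
  move=> Qloc; rewrite openE => r Qr; rewrite /interior/=.
  have := clamp_continuous (Qloc (clamp r)).
  by apply: filterS => r' /= [_]; exact.
have cR : connected [set: R] by apply/connected_intervalP.
have BT : [set r : R | P (clamp r)] = setT.
  apply: cR; first by exists 0.
    by exists [set r : R | P (clamp r)]; [exact: openP|rewrite setTI].
  exists [set r : R | P (clamp r)]; last by rewrite setTI.
  rewrite -openC; apply: (openP (fun s => ~ P s)) => s0.
  by apply: filterS (Ploc s0) => s [? ?]; split; apply: contra_not.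
move=> s; rewrite -(clampK s).
by have : [set: R] (set_val s) by []; rewrite -BT.
Qed.

End IntervalInduction.

(** The simplices and the unit interval are subtypes, whereas the compactness
    results about segments and boxes are about subsets of the ambient space. *)
Lemma compact_set_type (T : topologicalType) (A : set T) :
  compact A -> compact [set: set_type A].
Proof.
move=> /compact_near_coveringP cA; apply/compact_near_coveringP => I F P FF Pnear.
pose Q i t := forall At : t \in A, P i (SigSub At).
have: \forall i \near F, A `<=` Q i.
  apply: cA => t At.
  have [[U V] /= [[W [[O oO <-] tO] OU] FV] UV] := Pnear (SigSub (mem_set At)) Logic.I.
  exists (O, V) => /=; first by split=> //; exact: open_nbhs_nbhs.
  move=> [t' i] /= [Ot' Vi] At'; apply: (UV (SigSub At', i)); split => //=.
  exact: OU.
by apply: filterS => i AQ t _; move: (AQ _ (set_valP t) (mem_set (set_valP t)));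
   congr P; exact: val_inj.
Qed.

(** * The circle group *)

Section Circle.
Variable R : realType.

Definition circle_set : set (R * R)%type := [set z | z.1 ^+ 2 + z.2 ^+ 2 = 1].
Definition circle : Type := set_type circle_set.
HB.instance Definition _ := Topological.on circle.

Definition cre (z : circle) : R := (set_val z).1.
Definition cim (z : circle) : R := (set_val z).2.

Lemma circle_norm z : cre z ^+ 2 + cim z ^+ 2 = 1.
Proof. exact: (set_valP z). Qed.

Definition mkcircle (a b : R) (h : a ^+ 2 + b ^+ 2 = 1) : circle :=
  SigSub (mem_set (h : circle_set (a, b))).

Lemma circle_ext z w : cre z = cre w -> cim z = cim w -> z = w.
Proof.
move=> re im; apply: val_inj.
by rewrite [LHS]surjective_pairing [RHS]surjective_pairing; congr pair.
Qed.

Lemma mulc_norm z w : (cre z * cre w - cim z * cim w) ^+ 2 +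
  (cre z * cim w + cim z * cre w) ^+ 2 = 1.
Proof.
transitivity ((cre z ^+ 2 + cim z ^+ 2) * (cre w ^+ 2 + cim w ^+ 2)); first ring.
by rewrite !circle_norm mulr1.
Qed.

Definition mulc z w : circle := mkcircle (mulc_norm z w).

Lemma cre_mulc z w : cre (mulc z w) = cre z * cre w - cim z * cim w.
Proof. by []. Qed.
Lemma cim_mulc z w : cim (mulc z w) = cre z * cim w + cim z * cre w.
Proof. by []. Qed.

Lemma conjc_norm z : cre z ^+ 2 + (- cim z) ^+ 2 = 1.
Proof. by rewrite sqrrN circle_norm. Qed.

Definition conjc z : circle := mkcircle (conjc_norm z).

Lemma cre_conjc z : cre (conjc z) = cre z. Proof. by []. Qed.
Lemma cim_conjc z : cim (conjc z) = - cim z. Proof. by []. Qed.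

Definition cis (t : R) : circle := mkcircle (cos2Dsin2 t).

Lemma cre_cis t : cre (cis t) = cos t. Proof. by []. Qed.
Lemma cim_cis t : cim (cis t) = sin t. Proof. by []. Qed.

Definition sqc z : circle := mulc z z.

(** The antipode is the rotation by pi, so that the rotations by pi * s for s in
    [0, 1] connect it to the identity. *)
Definition oppc z : circle := mulc (cis pi) z.

Definition circE := (cre_mulc, cim_mulc, cre_conjc, cim_conjc, cre_cis, cim_cis,
  cos0, sin0, cospi, sinpi).

Lemma cre_oppc z : cre (oppc z) = - cre z.
Proof. by rewrite !circE; ring. Qed.
Lemma cim_oppc z : cim (oppc z) = - cim z.
Proof. by rewrite !circE; ring. Qed.

Lemma mulcA : associative mulc.
Proof. by move=> x y z; apply: circle_ext; rewrite !circE; ring. Qed.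
Lemma mulcC : commutative mulc.
Proof. by move=> x y; apply: circle_ext; rewrite !circE; ring. Qed.
Lemma mul1c z : mulc (cis 0) z = z.
Proof. by apply: circle_ext; rewrite !circE; ring. Qed.
Lemma mulcV z : mulc z (conjc z) = cis 0.
Proof.
by apply: circle_ext; rewrite !circE; [rewrite -(circle_norm z)|]; ring.
Qed.

Lemma sqc_oppc z : sqc (oppc z) = sqc z.
Proof. by apply: circle_ext; rewrite !circE; ring. Qed.

Lemma oppcK : involutive oppc.
Proof. by move=> z; apply: circle_ext; rewrite ?cre_oppc ?cim_oppc opprK. Qed.

(** The real part of z / w.  It is 1 if z = w, - 1 if z and w are antipodal,
    and its sign therefore separates the two square roots of a point. *)
Definition dotc z w := cre (mulc z (conjc w)).

Lemma dotcC z w : dotc z w = dotc w z.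
Proof. by rewrite /dotc !circE; ring. Qed.

Lemma dotcc z : dotc z z = 1.
Proof. by rewrite /dotc mulcV !circE. Qed.

Lemma dotNcc z : dotc (oppc z) z = -1.
Proof. by rewrite /dotc -mulcA mulcV !circE; ring. Qed.

Lemma sqc_inj_opp z w : sqc z = sqc w -> z = w \/ z = oppc w.
Proof.
move=> zw; have ere := congr1 cre zw; have eim := congr1 cim zw.
rewrite !circE in ere eim.
have nz := circle_norm z; have nw := circle_norm w.
have re2 : (cre z - cre w) * (cre z + cre w) = 0 by lra.
have im2 : (cim z - cim w) * (cim z + cim w) = 0 by lra.
have {}eim : cre z * cim z = cre w * cim w by lra.
have [a0|a0] := eqVneq (cre w) 0.
  have z0 : cre z = 0.
    by move/eqP: re2; rewrite a0 subr0 addr0 mulf_eq0 orbb => /eqP.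
  move/eqP: im2; rewrite mulf_eq0 subr_eq0 addr_eq0 => /orP[|] /eqP ez.
    by left; apply: circle_ext; rewrite ?a0.
  by right; apply: circle_ext; rewrite ?cre_oppc ?cim_oppc ?a0 ?oppr0.
move/eqP: re2; rewrite mulf_eq0 subr_eq0 addr_eq0 => /orP[|] /eqP ez.
  by left; apply: circle_ext => //; apply: (mulfI a0); rewrite -eim ez.
right; apply: circle_ext; rewrite ?cre_oppc ?cim_oppc//.
by apply: (mulfI a0); rewrite ez in eim; lra.
Qed.

Lemma continuous_cre : continuous cre.
Proof. exact: (cts_comp (@cts_set_val _ circle_set) (@cts_fst _ _)). Qed.
Lemma continuous_cim : continuous cim.
Proof. exact: (cts_comp (@cts_set_val _ circle_set) (@cts_snd _ _)). Qed.

Section ContinuousMaps.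
Variable T : topologicalType.
Implicit Types f g : T -> circle.

Lemma continuous_circle f :
  continuous (cre \o f) -> continuous (cim \o f) -> continuous f.
Proof.
move=> fre fim; apply: (@continuous_set_val _ _ circle_set).
rewrite (_ : (fun t => _) = (fun t => (cre (f t), cim (f t)))).
  exact: cts_pair.
by apply: funext => t; rewrite [LHS]surjective_pairing.
Qed.

Lemma continuous_mulc f g : continuous f -> continuous g ->
  continuous (fun t => mulc (f t) (g t)).
Proof.
move=> cf cg; have cfr := cts_comp cf continuous_cre.
have cfi := cts_comp cf continuous_cim.
have cgr := cts_comp cg continuous_cre.
have cgi := cts_comp cg continuous_cim.
apply: continuous_circle => t.
  apply: (@cvgB _ _ _ (nbhs t) _ (fun t => cre (f t) * cre (g t))).
    by apply: cvgM; [exact: cfr|exact: cgr].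
  by apply: cvgM; [exact: cfi|exact: cgi].
apply: (@cvgD _ _ _ (nbhs t) _ (fun t => cre (f t) * cim (g t))).
  by apply: cvgM; [exact: cfr|exact: cgi].
by apply: cvgM; [exact: cfi|exact: cgr].
Qed.

Lemma continuous_conjc f : continuous f -> continuous (fun t => conjc (f t)).
Proof.
move=> cf; apply: continuous_circle.
  exact: (cts_comp cf continuous_cre).
by move=> t; apply: cvgN; exact: (cts_comp cf continuous_cim).
Qed.

Lemma continuous_dotc f g : continuous f -> continuous g ->
  continuous (fun t => dotc (f t) (g t)).
Proof.
move=> cf cg; apply: cts_comp continuous_cre.
exact: continuous_mulc (continuous_conjc cg).
Qed.

End ContinuousMaps.

Lemma continuous_cis : continuous cis.
Proof.
by apply: continuous_circle; [exact: continuous_cos|exact: continuous_sin].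
Qed.

Lemma continuous_sqc : continuous sqc.
Proof. by apply: continuous_mulc => z; exact: cvg_id. Qed.
HB.instance Definition _ := isContinuous.Build _ _ sqc continuous_sqc.

Lemma continuous_oppc : continuous oppc.
Proof.
apply: (@continuous_mulc _ (fun=> cis pi) id) => z; last exact: cvg_id.
exact: (@cst_continuous circle circle (cis pi)).
Qed.
HB.instance Definition _ := isContinuous.Build _ _ oppc continuous_oppc.

(** The point (1 + z) / |1 + z| in coordinates: its real part is the cosine of
    half the argument of z. *)
Definition half_root_val (z : circle) : R * R :=
  let c := Num.sqrt ((1 + cre z) / 2) in (c, cim z / (2 * c)).

Lemma half_root_norm z : -1 < cre z -> circle_set (half_root_val z).
Proof.
move=> z1; rewrite /circle_set/=; set c := Num.sqrt _.
have c2 : c ^+ 2 = (1 + cre z) / 2 by rewrite sqr_sqrtr//; lra.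
have c0 : c != 0 by rewrite sqrtr_eq0 -ltNge; lra.
have -> : cim z / (2 * c) = cim z / 2 / c by field.
rewrite expr_div_n c2.
have nz := circle_norm z.
have -> : (cim z / 2) ^+ 2 = (1 - cre z ^+ 2) / 4.
  have -> : cre z ^+ 2 = 1 - cim z ^+ 2 by lra.
  by field.
by field; apply/eqP; lra.
Qed.

(** The square root with positive real part; the value 1 at z = - 1 is
    arbitrary. *)
Definition half_root z : circle :=
  if pselect (-1 < cre z) is left z1 then SigSub (mem_set (half_root_norm z1))
  else cis 0.

Lemma half_rootE z : -1 < cre z -> set_val (half_root z) = half_root_val z.
Proof. by rewrite /half_root; case: pselect. Qed.

Lemma half_rootK z : -1 < cre z -> sqc (half_root z) = z.
Proof.
move=> z1; have nz := circle_norm z.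
have c2 : Num.sqrt ((1 + cre z) / 2) ^+ 2 = (1 + cre z) / 2.
  by rewrite sqr_sqrtr//; lra.
have c0 : Num.sqrt ((1 + cre z) / 2) != 0 by rewrite sqrtr_eq0 -ltNge; lra.
have im2 : cim (half_root z) = cim z / (2 * cre (half_root z)).
  by rewrite /cre /cim half_rootE.
have re2 : cre (half_root z) ^+ 2 = (1 + cre z) / 2.
  by rewrite /cre half_rootE.
have re0 : cre (half_root z) != 0 by rewrite /cre half_rootE.
have nr := circle_norm (half_root z).
apply: circle_ext; rewrite !circE; first by lra.
by rewrite im2; field.
Qed.

Lemma half_root1 : half_root (cis 0) = cis 0.
Proof.
have h : -1 < cre (cis 0) by rewrite !circE; lra.
have s1 : Num.sqrt ((1 + 1) / 2 : R) = 1.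
  by rewrite -[1 + 1]/(2 : R) divff ?pnatr_eq0 ?sqrtr1.
have e : set_val (half_root (cis 0)) = (1, 0).
  by rewrite half_rootE// /half_root_val !circE s1 mul0r.
by apply: circle_ext; rewrite /cre /cim e /= ?cos0 ?sin0.
Qed.

Lemma continuous_half_root (T : topologicalType) (f : T -> circle) :
  continuous f -> (forall t, -1 < cre (f t)) ->
  continuous (fun t => half_root (f t)).
Proof.
move=> cf f1; have cfr := cts_comp cf continuous_cre.
have cs : continuous (fun t => Num.sqrt ((1 + cre (f t)) / 2)).
  apply: (@cts_comp _ _ _ (fun t => (1 + cre (f t)) / 2) Num.sqrt);
    last exact: sqrt_continuous.
  move=> t.
  by apply: cvgMr_tmp; apply: cvgD; [exact: cvg_cst|exact: cfr].
apply: continuous_circle.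
  rewrite (_ : _ \o _ = (fun t => Num.sqrt ((1 + cre (f t)) / 2)))//.
  by apply: funext => t; rewrite /= /cre half_rootE.
rewrite (_ : _ \o _ =
  (fun t => cim (f t) / (2 * Num.sqrt ((1 + cre (f t)) / 2)))); last first.
  by apply: funext => t; rewrite /= {1}/cim half_rootE.
move=> t; apply: cvgM; first exact: (cts_comp cf continuous_cim).
apply: cvgV.
  by rewrite mulf_neq0 ?pnatr_eq0// sqrtr_eq0 -ltNge; have := f1 t; lra.
by apply: cvgMl_tmp; exact: cs.
Qed.

End Circle.

(** * Continuous square roots of circle-valued maps *)

Section SquareRoots.
Variable R : realType.
Local Notation circle := (circle R).
Local Notation I := (unit_interval R).

Lemma sqc_mulc (z w : circle) : sqc (mulc z w) = mulc (sqc z) (sqc w).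
Proof. by rewrite /sqc -!mulcA; congr mulc; rewrite mulcA [mulc w z]mulcC -mulcA. Qed.

Lemma sqc_surj (z : circle) : exists w, sqc w = z.
Proof.
have [z1|z1] := ltP (-1) (cre z); first by exists (half_root z); exact: half_rootK.
(* Only z = - 1 is left: the root of - z is rotated by a quarter turn. *)
exists (mulc (cis (pi / 2)) (half_root (oppc z))).
rewrite sqc_mulc half_rootK ?cre_oppc; last by lra.
have -> : sqc (cis (pi / 2)) = cis pi :> circle.
  by apply: circle_ext; rewrite !circE cos_pihalf sin_pihalf; ring.
exact: oppcK.
Qed.

(** Two maps that are nowhere antipodal have a quotient that avoids - 1, and the
    principal square root of the quotient corrects a square root of the one to a
    square root of the other.  The correction is 1 where the two maps agree,
    which is what keeps closed loops closed. *)
Lemma sqrt_close (K : topologicalType) (f f' g : K -> circle) :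
  continuous f -> continuous f' -> continuous g ->
  (forall x, -1 < dotc (f' x) (f x)) -> (forall x, sqc (g x) = f x) ->
  exists g' : K -> circle, [/\ continuous g', forall x, sqc (g' x) = f' x
    & forall x, f' x = f x -> g' x = g x].
Proof.
move=> cf cf' cg ff' gf.
exists (fun x => mulc (half_root (mulc (f' x) (conjc (f x)))) (g x)); split.
- apply: continuous_mulc => //; apply: continuous_half_root => //.
  exact: continuous_mulc (continuous_conjc cf).
- move=> x; rewrite sqc_mulc half_rootK; last exact: ff'.
  by rewrite gf -mulcA [mulc (conjc _) _]mulcC mulcV mulcC mul1c.
- by move=> x ->; rewrite mulcV half_root1 mul1c.
Qed.

(** Compactness of [K] makes the maps H (_, s) and H (_, s0) nowhere antipodal
    for s close to s0, uniformly on [K], so that having a square root is a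
    locally constant property of s.  On the set [A] where the homotopy is
    stationary, the square root does not move either. *)
Lemma sqrt_homotopy (K : topologicalType) (A : set K)
    (H : K * I -> circle) (g0 : K -> circle) :
  compact [set: K] -> continuous H ->
  (forall x s, A x -> H (x, s) = H (x, clamp 0)) ->
  continuous g0 -> (forall x, sqc (g0 x) = H (x, clamp 0)) ->
  exists g1 : K -> circle, [/\ continuous g1,
    forall x, sqc (g1 x) = H (x, clamp 1) & forall x, A x -> g1 x = g0 x].
Proof.
move=> /compact_near_coveringP cK cH HA cg0 g0H.
have cHs s : continuous (fun x => H (x, s)).
  apply: (cts_comp _ cH); apply: cts_pair => x; [exact: cvg_id|exact: cvg_cst].
pose P s := exists g : K -> circle, [/\ continuous g,
  forall x, sqc (g x) = H (x, s) & forall x, A x -> g x = g0 x].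
suff : forall s, P s by exact.
apply: unit_interval_ind; last by exists g0.
have step s t : (forall x, -1 < dotc (H (x, t)) (H (x, s))) -> P s -> P t.
  move=> close [g [cg gs gA]].
  have [g' [cg' gt gg']] := sqrt_close (cHs s) (cHs t) cg close gs.
  by exists g'; split=> // x Ax; rewrite gg' ?gA // HA // HA.
move=> s0.
have : \forall s \near s0,
    [set: K] `<=` (fun x => -1 < dotc (H (x, s)) (H (x, s0))).
  apply: (cK I (nbhs s0) (fun s x => -1 < dotc (H (x, s)) (H (x, s0)))) => x _.
  have cd : continuous (fun p : K * I => dotc (H p) (H (p.1, s0))).
    apply: continuous_dotc => //; apply: (cts_comp _ cH).
    by apply: cts_pair; [exact: cts_fst|move=> p; exact: cvg_cst].
  have d1 : -1 < dotc (H (x, s0)) (H (x, s0)) by rewrite dotcc; lra.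
  have near_d : \forall p \near (x, s0), -1 < dotc (H p) (H (p.1, s0)).
    exact: (cd (x, s0) _ (lt_nbhsr d1)).
  by apply: filterS near_d => -[x' s] /=.
apply: filterS => s close; split; apply: step => x; last exact: close.
by rewrite dotcC; exact: close.
Qed.

(** The time parameter runs from the constant map to the identity: square roots
    are transported in the direction of increasing time, from the constant
    map. *)
Definition contraction_to (K : topologicalType) (x0 : K) (c : K * I -> K) :=
  [/\ continuous c, forall x, c (x, clamp 0) = x0 & forall x, c (x, clamp 1) = x].

Lemma sqrt_exists (K : topologicalType) (x0 : K) c (f : K -> circle) :
  compact [set: K] -> contraction_to x0 c -> continuous f ->
  exists2 g : K -> circle, continuous g & forall x, sqc (g x) = f x.
Proof.
move=> cK [cc c0 c1] cf; have [w wE] := sqc_surj (f x0).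
have [||||g [cg gf _]] := @sqrt_homotopy K set0 (f \o c) (fun=> w) cK.
- exact: (cts_comp cc cf).
- by [].
- by move=> x; exact: cvg_cst.
- by move=> x /=; rewrite c0.
by exists g => // x; rewrite gf /= c1.
Qed.

(** Two square roots agree up to sign at the centre of the contraction; along
    each path of the contraction the sign is locally constant. *)
Lemma sqrt_unique (K : topologicalType) (x0 : K) c (g h : K -> circle) :
  contraction_to x0 c -> continuous g -> continuous h ->
  (forall x, sqc (g x) = sqc (h x)) -> g =1 h \/ g =1 @oppc R \o h.
Proof.
move=> [cc c0 c1].
suff agree (g' h' : K -> circle) : continuous g' -> continuous h' ->
    (forall x, sqc (g' x) = sqc (h' x)) -> g' x0 = h' x0 -> g' =1 h'.
  move=> cg ch gh; have [e|e] := sqc_inj_opp (gh x0).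
    by left; apply: agree.
  right; apply: agree => // [|x]; first exact: cts_comp ch (@continuous_oppc R).
  by rewrite /= sqc_oppc.
move=> cg ch gh e0 x; rewrite -(c1 x).
apply: (@unit_interval_ind R (fun s => g' (c (x, s)) = h' (c (x, s)))); last first.
  by rewrite c0.
have eqE y : g' y = h' y <-> 0 < dotc (g' y) (h' y).
  split=> [->|]; first by rewrite dotcc.
  by case: (sqc_inj_opp (gh y)) => [//|->]; rewrite dotNcc oppr_gt0 ltr10.
have eqN y : g' y <> h' y <-> dotc (g' y) (h' y) < 0.
  split=> [|d0 e]; last by move: d0; rewrite e dotcc ltr10.
  by case: (sqc_inj_opp (gh y)) => [//|->]; rewrite dotNcc; lra.
have cx : continuous (fun s => c (x, s)).
  apply: (cts_comp _ cc); apply: cts_pair; [exact: cst_continuous|].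
  by move=> s; exact: cvg_id.
have cd : continuous (fun s => dotc (g' (c (x, s))) (h' (c (x, s)))).
  by apply: continuous_dotc; [exact: cts_comp cx cg|exact: cts_comp cx ch].
move=> s0; have [e|e] := pselect (g' (c (x, s0)) = h' (c (x, s0))).
  have /eqE d0 := e.
  have near_d : \forall s \near s0, 0 < dotc (g' (c (x, s))) (h' (c (x, s))).
    exact: (cd s0 _ (lt_nbhsr d0)).
  by apply: filterS near_d => s ds; split=> // _; exact/eqE.
have /eqN d0 := e.
have near_d : \forall s \near s0, dotc (g' (c (x, s))) (h' (c (x, s))) < 0.
  exact: (cd s0 _ (lt_nbhsl d0)).
by apply: filterS near_d => s ds; split=> // es; move/eqN: ds.
Qed.

End SquareRoots.

(** * Maps between simplices *)

Section SimplexMaps.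
Variable R : realType.
Local Notation simplex := (simplex R).

Definition coord_sum n (S : pred 'I_n.+1) (x : simplex n) : R :=
  \sum_(j | S j) set_val x ord0 j.

Lemma coord_sum_bounds n (S : pred 'I_n.+1) (x : simplex n) :
  0 <= coord_sum S x <= 1.
Proof.
have [x_ge0 x_sum] := set_valP x; rewrite sumr_ge0//=.
by rewrite -x_sum [leRHS](bigID S)/= lerDl sumr_ge0.
Qed.

Lemma coord_sumT n (x : simplex n) : coord_sum xpredT x = 1.
Proof. by have [_] := set_valP x. Qed.

Lemma continuous_row_sum n (S : pred 'I_n) :
  continuous (fun x : 'rV[R]_n => \sum_(j | S j) x ord0 j).
Proof.
have csum (r : seq 'I_n) :
    continuous (fun x : 'rV[R]_n => \sum_(j <- r | S j) x ord0 j).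
  elim: r => [|j r IH].
    under eq_fun do rewrite big_nil; exact: cst_continuous.
  under eq_fun do rewrite big_cons; case: (S j) => // x.
  by apply: (@cvgD _ _ _ (nbhs x)); [exact: continuous_coord|exact: IH].
exact: csum.
Qed.

Lemma continuous_coord_sum n (S : pred 'I_n.+1) : continuous (@coord_sum n S).
Proof. exact: cts_comp (@cts_set_val _ _) (@continuous_row_sum _ S). Qed.

Section VertexMap.
Variables (m n : nat) (phi : 'I_m.+1 -> 'I_n.+1).

(** The affine map between simplices given on vertices by [phi]: the coordinate
    of the image at a vertex k is the total mass of the fibre of k.  Faces and
    degeneracies are both of this form, which reduces identities between them to
    identities between maps of finite ordinals. *)
Definition vertex_map_row (x : simplex m) : 'rV[R]_n.+1 :=
  \row_k coord_sum (fun j => phi j == k) x.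

Lemma vertex_map_subproof (x : simplex m) :
  vertex_map_row x \in @simplex_set R n.
Proof.
apply/mem_set; split=> [k|].
  by rewrite mxE; have /andP[] := coord_sum_bounds (fun j => phi j == k) x.
under eq_bigr do rewrite mxE.
rewrite -[RHS](coord_sumT x) /coord_sum.
by rewrite [RHS](partition_big phi xpredT).
Qed.

Definition vertex_map (x : simplex m) : simplex n := SigSub (vertex_map_subproof x).

Lemma vertex_map_continuous : continuous vertex_map.
Proof.
apply: (@continuous_set_val _ _ (@simplex_set R n)); apply: continuous_mx => i k /=.
under eq_fun do rewrite mxE.
exact: continuous_coord_sum.
Qed.

Lemma coord_sum_vertex_map (S : pred 'I_n.+1) x :
  coord_sum S (vertex_map x) = coord_sum (S \o phi) x.
Proof.
rewrite /coord_sum [RHS](partition_big phi S)//=.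
apply: eq_bigr => k Sk; rewrite mxE; apply: eq_bigl => j /=.
by case: eqP => [->|]; rewrite ?andbF ?Sk.
Qed.

End VertexMap.

Lemma vertex_map_comp l m n (phi : 'I_l.+1 -> 'I_m.+1) (psi : 'I_m.+1 -> 'I_n.+1) x :
  vertex_map psi (vertex_map phi x) = vertex_map (psi \o phi) x.
Proof.
apply: val_inj; apply/rowP => k.
by rewrite [LHS]mxE [RHS]mxE coord_sum_vertex_map.
Qed.

Lemma vertex_map_id n (x : simplex n) : vertex_map id x = x.
Proof.
apply: val_inj; apply/rowP => k.
by rewrite [LHS]mxE /coord_sum big_pred1_eq.
Qed.

Lemma faceE n (i : 'I_n.+2) (x : simplex n) :
  face R i x = vertex_map (fintype.lift i) x.
Proof.
apply: val_inj; apply/rowP => j; rewrite [LHS]mxE [RHS]mxE /coord_sum.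
case: unliftP => [k ->|->] /=.
  by rewrite (big_pred1 k)// => l; rewrite (inj_eq lift_inj).
by rewrite big_pred0// => l; rewrite eq_sym (negbTE (neq_lift _ _)).
Qed.

End SimplexMaps.

(** * The prism operator and homotopy invariance *)

(** The combinatorics of the boundary of a prism.  Below, A i j is face j of the
    i-th cell of the prism over a simplex, and B i j the i-th cell of the prism
    over face j of that simplex.  In row i, the two faces j = i and j = i + 1
    are consecutive horizontal slices, whose differences telescope; the other
    faces are cells of the prisms over the faces, with one of the two indices
    lowered by 1, hence with the opposite sign. *)
Section AlternatingSum.
Variables (V : lmodType rat) (n : nat) (A B : nat -> nat -> V) (q : nat -> V).
Hypothesis Adiag : forall i, (i < n.+1)%N -> A i i = q i.
Hypothesis Adiag1 : forall i, (i < n.+1)%N -> A i i.+1 = q i.+1.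
Hypothesis Alow : forall i j, (j < i < n.+1)%N -> A i j = B i.-1 j.
Hypothesis Ahigh : forall i j, (i.+1 < j < n.+2)%N -> A i j = B i j.-1.

Let s k : rat := (-1) ^+ k.

Lemma prism_row i : (i < n.+1)%N ->
  \sum_(0 <= j < n.+2) s (i + j) *: A i j =
  \sum_(0 <= j < i) s (i + j) *: B i.-1 j + (q i - q i.+1)
  - \sum_(i.+1 <= j < n.+1) s (i + j) *: B i j.
Proof.
move=> i_n.
rewrite (@big_cat_nat _ _ _ i) //=; last by lia.
rewrite (@big_ltn _ _ _ i) 1?(@big_ltn _ _ _ i.+1); [|lia..].
rewrite -!addrA; congr (_ + _).
  rewrite !big_nat; apply: eq_bigr => j /andP[_ ji].
  by rewrite Alow ?ji.
rewrite Adiag// Adiag1// addnS /s exprS addnn -mul2n exprM sqrrN !expr1n.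
rewrite mulr1 scale1r scaleN1r; congr (_ + (_ + _)).
rewrite big_add1 /= -sumrN !big_nat; apply: eq_bigr => j /andP[ij jn].
rewrite Ahigh; last by lia.
by rewrite addnS exprS mulN1r scaleNr.
Qed.

Lemma prism_sum :
  \sum_(0 <= i < n.+1) \sum_(0 <= j < n.+2) s (i + j) *: A i j =
  q 0%N - q n.+1
  - \sum_(0 <= i < n) \sum_(0 <= j < n.+1) s (i + j) *: B i j.
Proof.
transitivity (\sum_(0 <= i < n.+1)
    (\sum_(0 <= j < i) s (i + j) *: B i.-1 j + (q i - q i.+1)
     - \sum_(i.+1 <= j < n.+1) s (i + j) *: B i j)).
  by rewrite !big_nat; apply: eq_bigr => i /andP[_]; exact: prism_row.
have tele : \sum_(0 <= i < n.+1) (q i - q i.+1) = q 0%N - q n.+1.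
  rewrite (@telescope_sumr_eq _ _ _ (fun i => - q i)) // 1?opprK 1?[RHS]addrC //.
  by move=> k _; rewrite opprK [RHS]addrC.
rewrite sumrB big_split /= tele [X in X - _]addrC -addrA; congr (_ + _).
rewrite big_nat_recl//= big_nil add0r big_nat_recr//= [X in _ - (_ + X)]big_geq// addr0.
rewrite -sumrB -sumrN !big_nat; apply: eq_bigr => i /andP[_ i_n].
rewrite [in RHS](@big_cat_nat _ _ _ i.+1)//=; last by lia.
rewrite opprD; congr (_ - _); rewrite -sumrN; apply: eq_bigr => j _.
by rewrite /s addSn exprS mulN1r scaleNr.
Qed.

End AlternatingSum.

Section PrismOperator.
Variable R : realType.
Variables X Y : topologicalType.
Variable H : continuousType (X * unit_interval R)%type Y.

Section PrismSimplex.
Variables (m n : nat) (phi : 'I_m.+1 -> 'I_n.+1) (S : pred 'I_m.+1).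
Variable sigma : continuousType (simplex R n) X.

(** The affine simplex in the prism over [sigma] whose vertex j lies over vertex
    [phi] j, on the top level if [S] j holds and on the bottom level otherwise,
    followed by [H]. *)
Definition prism_fun (x : simplex R m) : Y :=
  H (sigma (vertex_map phi x), clamp (coord_sum S x)).

Lemma prism_continuous : continuous prism_fun.
Proof.
apply: (cts_comp _ (@cts_fun _ _ H)); apply: cts_pair.
  exact: (cts_comp (@vertex_map_continuous _ _ _ phi) (@cts_fun _ _ sigma)).
exact: (cts_comp (@continuous_coord_sum R m S) (@clamp_continuous R)).
Qed.

Definition prism_simplex : continuousType (simplex R m) Y := mkcts prism_continuous.

End PrismSimplex.

Lemma prism_face m n (phi : 'I_m.+2 -> 'I_n.+1) S sigma (i : 'I_m.+2) :
  comp_cts (prism_simplex phi S sigma) (face R i) =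
  prism_simplex (phi \o fintype.lift i) (S \o fintype.lift i) sigma.
Proof.
apply/continuousEP => x.
change (prism_fun phi S sigma (face R i x) =
  prism_fun (phi \o fintype.lift i) (S \o fintype.lift i) sigma x).
by rewrite /prism_fun faceE vertex_map_comp coord_sum_vertex_map.
Qed.

Lemma prism_of_face m n (phi : 'I_m.+1 -> 'I_n.+1) S sigma (i : 'I_n.+2) :
  prism_simplex phi S (comp_cts sigma (face R i)) =
  prism_simplex (fintype.lift i \o phi) S sigma.
Proof.
apply/continuousEP => x.
change (prism_fun phi S (comp_cts sigma (face R i)) x =
  prism_fun (fintype.lift i \o phi) S sigma x).
by rewrite /prism_fun /comp_cts/= faceE vertex_map_comp.
Qed.

Lemma eq_prism m n (phi psi : 'I_m.+1 -> 'I_n.+1) (S T : pred 'I_m.+1) sigma :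
  phi =1 psi -> S =1 T -> prism_simplex phi S sigma = prism_simplex psi T sigma.
Proof. by move=> /funext -> /funext ->. Qed.

(** As i ranges over the vertices, [prism_cell i] runs over the simplices
    [v_0, ..., v_i, w_i, ..., w_n] that triangulate the prism with bottom
    vertices v and top vertices w; here vertices i and i + 1 lie over the same
    vertex of the base. *)
Definition degeneracy n (i : nat) (j : 'I_n.+2) : 'I_n.+1 :=
  inord (if (j <= i)%N then j : nat else j.-1).

Definition prism_cell n (i : nat) sigma : continuousType (simplex R n.+1) Y :=
  @prism_simplex n.+1 n (degeneracy i) (fun j => (i < j)%N) sigma.

Definition prism n : chain R n X -> chain R n.+1 Y :=
  fglift (fun sigma => \sum_(0 <= i < n.+1) (-1) ^+ i *: << prism_cell i sigma >>).

HB.instance Definition _ n := GRing.isLinear.Build rat (chain R n X)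
  (chain R n.+1 Y) _ (@prism n) (@fglift_linear _ _ _ _).

Lemma prismU n (sigma : continuousType (simplex R n) X) :
  prism << sigma >> =
  \sum_(0 <= i < n.+1) (-1) ^+ i *: << prism_cell i sigma >> :> chain R n.+1 Y.
Proof. by rewrite /prism liftU scale1r. Qed.

Lemma degeneracyE n i (j : 'I_n.+2) : (i < n.+1)%N ->
  degeneracy i j = (if (j <= i)%N then j : nat else j.-1) :> nat.
Proof.
move=> i_n; rewrite inordK//; have := ltn_ord j.
by case: (leqP j i) => ?; lia.
Qed.

(** The common face of the cells k - 1 and k: the vertices before k are on the
    bottom level, the others on the top level.  The slices 0 and n + 1 are the
    top and the bottom of the prism. *)
Definition slice n k sigma : continuousType (simplex R n) Y :=
  @prism_simplex n n id (fun j => (k <= j)%N) sigma.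

(* Identities between compositions of face and degeneracy maps: every comparison
   of indices is decided, and linear arithmetic does the rest. *)
Ltac bump_lia := rewrite /= /bump ?inordK; [repeat (case: leqP => ?); lia|lia..].

Lemma prism_cell_diag n i (sigma : continuousType (simplex R n) X) :
  (i < n.+1)%N -> comp_cts (prism_cell i sigma) (face R (inord i)) = slice i sigma.
Proof.
move=> i_n; rewrite prism_face; apply: eq_prism => j.
  by apply: ord_inj; rewrite degeneracyE//; bump_lia.
by bump_lia.
Qed.

Lemma prism_cell_diag1 n i (sigma : continuousType (simplex R n) X) :
  (i < n.+1)%N ->
  comp_cts (prism_cell i sigma) (face R (inord i.+1)) = slice i.+1 sigma.
Proof.
move=> i_n; rewrite prism_face; apply: eq_prism => j.
  by apply: ord_inj; rewrite degeneracyE//; bump_lia.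
by bump_lia.
Qed.

Lemma prism_cell_low n i j (sigma : continuousType (simplex R n.+1) X) :
  (j < i < n.+2)%N -> comp_cts (prism_cell i sigma) (face R (inord j)) =
  prism_cell i.-1 (comp_cts sigma (face R (inord j))).
Proof.
move=> ijn; rewrite prism_face [RHS]prism_of_face; apply: eq_prism => k.
  apply: ord_inj; rewrite degeneracyE /=; last by lia.
  by rewrite /= degeneracyE; [|lia]; case: (leqP k i.-1) => ?; bump_lia.
by bump_lia.
Qed.

Lemma prism_cell_high n i j (sigma : continuousType (simplex R n.+1) X) :
  (i.+1 < j < n.+3)%N -> comp_cts (prism_cell i sigma) (face R (inord j)) =
  prism_cell i (comp_cts sigma (face R (inord j.-1))).
Proof.
move=> ijn; rewrite prism_face [RHS]prism_of_face; apply: eq_prism => k.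
  apply: ord_inj; rewrite degeneracyE /=; last by lia.
  by rewrite /= degeneracyE; [|lia]; case: (leqP k i) => ?; bump_lia.
by bump_lia.
Qed.

End PrismOperator.

Section Homotopy.
Variable R : realType.

Lemma boundary_simplexE n (X : topologicalType)
    (sigma : continuousType (simplex R n.+1) X) :
  boundary << sigma >> = \sum_(0 <= i < n.+2)
    (-1) ^+ i *: << comp_cts sigma (face R (inord i)) >> :> chain R n X.
Proof.
by rewrite boundaryU big_mkord; apply: eq_bigr => i _; rewrite inord_val.
Qed.

Section Invariance.
Variables (X Y : topologicalType) (H : continuousType (X * unit_interval R)%type Y).

Lemma boundary_prismU n (sigma : continuousType (simplex R n) X) :
  boundary (prism H << sigma >>) =
  \sum_(0 <= i < n.+1) \sum_(0 <= j < n.+2)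
    (-1) ^+ (i + j) *: << comp_cts (prism_cell H i sigma) (face R (inord j)) >>
  :> chain R n Y.
Proof.
rewrite prismU linear_sum; apply: eq_bigr => i _.
rewrite linearZ /= boundary_simplexE scaler_sumr.
by apply: eq_bigr => j _; rewrite scalerA -exprD.
Qed.

Lemma slice0 (f1 : continuousType X Y) n (sigma : continuousType (simplex R n) X) :
  (forall x, H (x, clamp 1) = f1 x) -> slice H 0 sigma = comp_cts f1 sigma.
Proof.
move=> H1; apply/continuousEP => x.
change (prism_fun H id (fun j => (0 <= j)%N) sigma x = f1 (sigma x)).
by rewrite /prism_fun vertex_map_id coord_sumT.
Qed.

Lemma slice_end (f0 : continuousType X Y) n (sigma : continuousType (simplex R n) X) :
  (forall x, H (x, clamp 0) = f0 x) -> slice H n.+1 sigma = comp_cts f0 sigma.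
Proof.
move=> H0; apply/continuousEP => x.
change (prism_fun H id (fun j : 'I_n.+1 => (n < j)%N) sigma x = f0 (sigma x)).
rewrite /prism_fun vertex_map_id /coord_sum big_pred0// => j.
by rewrite ltnNge -ltnS ltn_ord.
Qed.

Variables f0 f1 : continuousType X Y.
Hypothesis H0 : forall x, H (x, clamp 0) = f0 x.
Hypothesis H1 : forall x, H (x, clamp 1) = f1 x.

Lemma boundary_prism0 (c : chain R 0 X) :
  boundary (prism H c) = chain_map f1 c - chain_map f0 c.
Proof.
elim/chain_ind: c => [|k sigma c IH]; first by rewrite !linear0 ?addr0.
rewrite !linearP /= IH [RHS]addrACA -scalerDr; congr (_ *: _ + _).
rewrite boundary_prismU !chain_mapU -(slice0 _ H1) -(slice_end _ H0).
(* The base has no faces: the zero array B stands for an empty family. *)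
rewrite (@prism_sum _ _ _ (fun _ _ => 0) (fun k => << slice H k sigma >>)) => [||||].
- by rewrite big_geq ?subr0.
- by move=> i i_n; rewrite prism_cell_diag.
- by move=> i i_n; rewrite prism_cell_diag1.
- by move=> i j; lia.
- by move=> i j; lia.
Qed.

(** The prism operator is a chain homotopy; on 0-chains the second term of the
    homotopy formula is missing, see [boundary_prism0]. *)
Lemma boundary_prismS n (c : chain R n.+1 X) :
  boundary (prism H c) =
  chain_map f1 c - chain_map f0 c - prism H (boundary c).
Proof.
elim/chain_ind: c => [|k sigma c IH]; first by rewrite !linear0 ?addr0.
rewrite !linearP /= IH [X in _ = X + _]addrACA [RHS]addrACA -!scalerDr.
congr (_ *: _ + _).
rewrite boundary_prismU !chain_mapU -(slice0 _ H1) -(slice_end _ H0).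
rewrite (@prism_sum _ _ _
  (fun i j => << prism_cell H i (comp_cts sigma (face R (inord j))) >>)
  (fun k => << slice H k sigma >>)) => [||||].
- congr (_ - _); rewrite boundary_simplexE linear_sum exchange_big /=.
  apply: eq_bigr => j _; rewrite linearZ /= prismU scaler_sumr.
  by apply: eq_bigr => i _; rewrite scalerA -exprD addnC.
- by move=> i i_n; rewrite prism_cell_diag.
- by move=> i i_n; rewrite prism_cell_diag1.
- by move=> i j ijn; rewrite prism_cell_low.
- by move=> i j ijn; rewrite prism_cell_high.
Qed.

Lemma homotopic_cycles n (z : chain R n X) : is_cycle z ->
  exists c, boundary c = chain_map f1 z - chain_map f0 z.
Proof.
case: n z => [z _|n z /= z0]; exists (prism H z); first exact: boundary_prism0.
by rewrite boundary_prismS z0 linear0 subr0.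
Qed.

End Invariance.
End Homotopy.

(** * The transfer of the squaring map *)

Section Transfer.
Variable R : realType.
Local Notation circle := (circle R).
Local Notation simplex := (simplex R).

Lemma compact_simplex n : compact [set: simplex n].
Proof.
apply: compact_set_type.
have cbox := @rV_compact R n.+1 (fun=> `[0, 1]%classic)
  (fun=> @segment_compact R 0 1).
apply: (subclosed_compact _ cbox) => [|v [v0 v1] i /=]; last first.
  rewrite in_itv/= v0/= -v1 (bigD1 i)//= lerDl.
  by apply: sumr_ge0.
have -> : @simplex_set R n =
    \bigcap_(i in [set: 'I_n.+1]) ((fun v => v ord0 i) @^-1` [set r | 0 <= r])
    `&` (fun v => \sum_i v ord0 i) @^-1` [set r | r = 1].
  apply/seteqP; split=> [v [v0 v1]|v [v0 v1]]; split=> // i; last exact: v0.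
  by move=> _; exact: v0.
apply: closedI.
  apply: closed_bigI => i _; apply: preimage_closed; last exact: closed_ge.
  by move=> v _; exact: continuous_coord.
apply: preimage_closed; last exact: closed_eq.
by move=> v _; exact: continuous_row_sum.
Qed.

Definition vertex0_row n : 'rV[R]_n.+1 := \row_k (k == ord0)%:R.

Lemma vertex0_subproof n : vertex0_row n \in @simplex_set R n.
Proof.
apply/mem_set; split=> [k|]; first by rewrite mxE ler0n.
by rewrite (bigD1 ord0)//= mxE eqxx big1 ?addr0// => k /negbTE; rewrite mxE => ->.
Qed.

Definition vertex0 n : simplex n := SigSub (vertex0_subproof n).

Definition shrink_row n (p : simplex n * unit_interval R) : 'rV[R]_n.+1 :=
  \row_k (set_val p.2 * set_val p.1 ord0 k +
          (1 - set_val p.2) * vertex0_row n ord0 k).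

Lemma shrink_subproof n (p : simplex n * unit_interval R) :
  shrink_row p \in @simplex_set R n.
Proof.
have [x_ge0 x_sum] := @set_valP _ (@simplex_set R n) p.1.
have [v_ge0 v_sum] := @set_valP _ (@simplex_set R n) (vertex0 n).
have := set_valP p.2; rewrite /= in_itv => /andP[s0 s1].
apply/mem_set; split=> [k|].
  by rewrite mxE addr_ge0// mulr_ge0 ?subr_ge0//; exact: v_ge0.
under eq_bigr do rewrite mxE.
by rewrite big_split/= -!mulr_sumr x_sum [X in _ + _ * X]v_sum; ring.
Qed.

Definition shrink n (p : simplex n * unit_interval R) : simplex n :=
  SigSub (shrink_subproof p).

Lemma shrink_contraction n : contraction_to (vertex0 n) (@shrink n).
Proof.
split=> [|x|x].
- apply: (@continuous_set_val _ _ (@simplex_set R n)); apply: continuous_mx => i k /=.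
  under eq_fun do rewrite mxE.
  have cs : continuous (fun p : simplex n * unit_interval R => set_val p.2).
    exact: (cts_comp (@cts_snd _ _) (@cts_set_val _ `[0 : R, 1]%classic)).
  have cx : continuous (fun p : simplex n * unit_interval R => set_val p.1 ord0 k).
    exact: (cts_comp (cts_comp (@cts_fst _ _) (@cts_set_val _ (@simplex_set R n)))
                     (@continuous_coord _ _ _ ord0 k)).
  move=> p; apply: (@cvgD _ _ _ (nbhs p)).
    by apply: cvgM; [exact: cs|exact: cx].
  apply: cvgMr_tmp; apply: (@cvgB _ _ _ (nbhs p)); last exact: cs.
  exact: cst_continuous.
- apply: val_inj; apply/rowP => k; rewrite [LHS]mxE /= clampE ?lexx ?ler01//.
  by rewrite mul0r add0r subr0 mul1r.
- apply: val_inj; apply/rowP => k; rewrite [LHS]mxE /= clampE ?lexx ?ler01//.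
  by rewrite mul1r subrr mul0r addr0.
Qed.

Definition squaring : continuousType circle circle := @sqc R.
Definition antipode : continuousType circle circle := @oppc R.

(** Simplices are compact and contractible, so square roots of maps on them
    exist: every singular simplex of the circle lifts along the covering. *)
Lemma simplex_lift n (sigma : continuousType (simplex n) circle) :
  exists g : continuousType (simplex n) circle, comp_cts squaring g = sigma.
Proof.
have [g cg gE] := sqrt_exists (@compact_simplex n) (@shrink_contraction n)
  (@cts_fun _ _ sigma).
by exists (mkcts cg); apply/continuousEP => x; exact: gE.
Qed.

Definition some_lift n (sigma : continuousType (simplex n) circle) :=
  xget sigma [set g | comp_cts squaring g = sigma].

Lemma some_liftK n (sigma : continuousType (simplex n) circle) :
  comp_cts squaring (some_lift sigma) = sigma.
Proof.
by have [g gE] := simplex_lift sigma; rewrite /some_lift; case: xgetP => // /(_ g).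
Qed.

(** The sum of the two lifts.  The choice of [some_lift] does not matter, see
    [transferU]; this is what makes the transfer a chain map. *)
Definition transfer n : chain R n circle -> chain R n circle :=
  fglift (fun sigma => << some_lift sigma >> +
                       << comp_cts antipode (some_lift sigma) >>).

HB.instance Definition _ n := GRing.isLinear.Build rat (chain R n circle)
  (chain R n circle) _ (@transfer n) (@fglift_linear _ _ _ _).

Lemma transferU n (g : continuousType (simplex n) circle) :
  transfer << comp_cts squaring g >> =
  << g >> + << comp_cts antipode g >> :> chain R n circle.
Proof.
rewrite /transfer liftU scale1r.
set h := some_lift _.
have hg x : sqc (h x) = sqc (g x).
  have /continuousEP/(_ x) := some_liftK (comp_cts squaring g); exact.
have [e|e] := sqrt_unique (@shrink_contraction n) (@cts_fun _ _ h) (@cts_fun _ _ g) hg.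
  by have -> : h = g by exact/continuousEP.
have -> : h = comp_cts antipode g by apply/continuousEP.
rewrite addrC; congr (<< _ >> + _); apply/continuousEP => x.
exact: oppcK.
Qed.

Lemma comp_ctsA (X Y Z T : topologicalType) (h : continuousType Z T)
    (g : continuousType Y Z) (f : continuousType X Y) :
  comp_cts (comp_cts h g) f = comp_cts h (comp_cts g f).
Proof. exact/continuousEP. Qed.

Lemma transfer_boundary n (c : chain R n.+1 circle) :
  boundary (transfer c) = transfer (boundary c).
Proof.
elim/chain_ind: c => [|k sigma c IH]; first by rewrite !linear0.
rewrite !linearP/= IH; congr (_ *: _ + _).
rewrite -(some_liftK sigma) transferU linearD /= !boundaryU linear_sum -big_split.
apply: eq_bigr => i _; rewrite linearZ /= !comp_ctsA.
by rewrite transferU scalerDr.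
Qed.

Lemma transferK n (c : chain R n circle) : chain_map squaring (transfer c) = 2 *: c.
Proof.
elim/chain_ind: c => [|k sigma c IH]; first by rewrite !linear0.
rewrite !linearP/= IH; congr (_ *: _ + _).
rewrite -[in LHS](some_liftK sigma) transferU linearD /= !chain_mapU.
rewrite some_liftK -comp_ctsA.
have -> : comp_cts squaring antipode = squaring.
  by apply/continuousEP => x; exact: sqc_oppc.
by rewrite some_liftK -mulr2n -scaler_nat.
Qed.

Lemma transfer_squaring n (c : chain R n circle) :
  transfer (chain_map squaring c) = c + chain_map antipode c.
Proof.
elim/chain_ind: c => [|k sigma c IH]; first by rewrite !linear0 addr0.
by rewrite !linearP/= IH !chain_mapU transferU scalerDr addrACA.
Qed.

Definition rotation_fun (p : circle * unit_interval R) : circle :=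
  mulc (cis (pi * set_val p.2)) p.1.

Lemma rotation_continuous : continuous rotation_fun.
Proof.
apply: continuous_mulc; last exact: cts_fst.
apply: (cts_comp _ (@continuous_cis R)).
have cs : continuous (fun p : circle * unit_interval R => set_val p.2).
  exact: (cts_comp (@cts_snd _ _) (@cts_set_val _ `[0 : R, 1]%classic)).
by move=> p; apply: cvgMl_tmp; exact: cs.
Qed.

(** The antipodal map is homotopic to the identity through rotations. *)
Lemma antipode_cycles n (z : chain R n circle) : is_cycle z ->
  exists c, boundary c = chain_map antipode z - z.
Proof.
have H0 x : mkcts rotation_continuous (x, clamp 0) =
    (idfun : continuousType circle circle) x.
  by change (mulc (cis (pi * set_val (clamp 0 : unit_interval R))) x = x);
     rewrite clampE ?lexx ?ler01// mulr0 mul1c.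
have H1 x : mkcts rotation_continuous (x, clamp 1) = antipode x.
  by change (mulc (cis (pi * set_val (clamp 1 : unit_interval R))) x = oppc x);
     rewrite clampE ?lexx ?ler01// mulr1.
move=> /(homotopic_cycles H0 H1)[c cE]; exists c; rewrite cE; congr (_ - _).
elim/chain_ind: {cE} z => [|k sigma z IH]; first by rewrite linear0.
rewrite linearP/= IH chain_mapU; congr (_ *: << _ >> + _); exact/continuousEP.
Qed.

Lemma chain_map_cycle n (X Y : topologicalType) (f : continuousType X Y)
  (z : chain R n X) : is_cycle z -> is_cycle (chain_map f z).
Proof.
by case: n z => [//|n z /= z0]; rewrite chain_map_boundary z0 linear0.
Qed.

Lemma transfer_cycle n (z : chain R n circle) : is_cycle z -> is_cycle (transfer z).
Proof. by case: n z => [//|n z /= z0]; rewrite transfer_boundary z0 linear0. Qed.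

Lemma cycleB n X (y z : chain R n X) : is_cycle y -> is_cycle z -> is_cycle (y - z).
Proof. by case: n y z => [//|n y z /= y0 z0]; rewrite linearB/= y0 z0 subrr. Qed.

Lemma cycleZ n X (k : rat) (z : chain R n X) : is_cycle z -> is_cycle (k *: z).
Proof. by case: n z => [//|n z /= z0]; rewrite linearZ/= z0 scaler0. Qed.

Lemma homology_class_eq n X (y z : chain R n X) :
  \pi_(chain_mod_boundaries R n X) y = \pi_(chain_mod_boundaries R n X) z <->
  exists c, boundary c = y - z.
Proof.
split=> [/eqP|h]; last (apply/eqP; move: h); rewrite -Quotient.idealrBE.
  by move=> /asboolP.
by move=> h; apply/asboolP.
Qed.

(** Both composites of squaring with the transfer are multiplication by 2 on
    homology, so one half of the transfer is the inverse map. *)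
Theorem squaring_homology_iso : rational_homology_iso R squaring.
Proof.
move=> n; split.
- move=> _ [z zc ->]; rewrite homology_map_pi.
  by exists (chain_map squaring z) => //; exact: chain_map_cycle.
- move=> _ _ /set_mem[y yc ->] /set_mem[z zc ->].
  rewrite !homology_map_pi => /homology_class_eq[c cE]; apply/homology_class_eq.
  have wc := cycleB yc zc; set w := y - z in wc *.
  have [d dE] := antipode_cycles wc.
  (* The boundary of transfer c is w + a w and that of d is a w - w, where a is
     induced by the antipode: half the difference bounds w. *)
  exists (2^-1 *: (transfer c - d)).
  rewrite linearZ linearB /= transfer_boundary cE dE -linearB transfer_squaring -/w.
  rewrite opprB addrACA subrr addr0 -mulr2n -scaler_nat scalerA.
  by rewrite mulVf ?scale1r.
- move=> _ [z zc ->].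
  exists (\pi_(chain_mod_boundaries R n circle) (2^-1 *: transfer z)).
    by exists (2^-1 *: transfer z) => //; apply/cycleZ/transfer_cycle.
  by rewrite homology_map_pi linearZ /= transferK scalerA mulVf ?scale1r.
Qed.

End Transfer.

(** * The squaring map on the fundamental group *)

Section FundamentalGroup.
Variable R : realType.
Local Notation circle := (circle R).
Local Notation I := (unit_interval R).

Lemma compact_unit_interval : compact [set: I].
Proof. exact/compact_set_type/segment_compact. Qed.

Definition shrink_interval (p : I * I) : I := clamp (set_val p.2 * set_val p.1).

Lemma shrink_interval_contraction : contraction_to (clamp 0) shrink_interval.
Proof.
split=> [|u|u].
- apply: (cts_comp _ (@clamp_continuous R)).
  have cv := @cts_set_val _ `[0 : R, 1]%classic.
  by move=> p; apply: cvgM; [exact: (cts_comp (@cts_snd _ _) cv)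
                            |exact: (cts_comp (@cts_fst _ _) cv)].
- by rewrite /shrink_interval clampE ?lexx ?ler01// mul0r.
- by rewrite /shrink_interval clampE ?lexx ?ler01// mul1r clampK.
Qed.

Definition half_turn (u : I) : circle := cis (pi * set_val u).

Lemma half_turn0 : half_turn (clamp 0) = cis 0.
Proof. by rewrite /half_turn clampE ?lexx ?ler01// mulr0. Qed.

Lemma half_turn1 : half_turn (clamp 1) = oppc (cis 0).
Proof.
by rewrite /half_turn clampE ?lexx ?ler01// mulr1 /oppc mulcC mul1c.
Qed.

Lemma continuous_half_turn : continuous half_turn.
Proof.
apply: (cts_comp _ (@continuous_cis R)).
have cpi : continuous (fun r : R => pi * r).
  by move=> r; apply: cvgMl_tmp; exact: cvg_id.
exact: (cts_comp (@cts_set_val _ `[0 : R, 1]%classic) cpi).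
Qed.

(** A loop that is a square, but only of a path that is not closed. *)
Definition full_turn_fun (t : cube R 1) : circle := sqc (half_turn (t ord0 ord0)).

Lemma full_turn_continuous : continuous full_turn_fun.
Proof.
apply: (cts_comp _ (@continuous_sqc R)); apply: (cts_comp _ continuous_half_turn).
exact: continuous_coord.
Qed.

Lemma full_turn_boundary t :
  cube_boundary t -> mkcts full_turn_continuous t = squaring R (cis 0).
Proof.
move=> [i]; rewrite (ord1 i) => ti.
change (sqc (half_turn (t ord0 ord0)) = sqc (cis 0)).
rewrite -[t _ _]clampK; case: ti => ->; first by rewrite half_turn0.
by rewrite half_turn1 sqc_oppc.
Qed.

Definition full_turn : loop R 1 (squaring R (cis 0)) := mk_loop full_turn_boundary.

(** A homotopy from the square of a loop [a] to the full turn, stationary at the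
    endpoints, carries the square root [a] of its source to a square root g of
    the full turn with the same value 1 at both endpoints.  But g can only be
    plus or minus [half_turn], whose values at the endpoints are antipodal. *)
Lemma full_turn_not_squared (a : loop R 1 (cis 0 : circle)) :
  ~~ loop_rel (loop_map (squaring R) a) full_turn.
Proof.
apply/negP => /asboolP[H [H0 H1 Hx]].
pose pt (u : I) : cube R 1 := \row_j u.
have cpt : continuous pt.
  apply: continuous_mx => i j; under eq_fun do rewrite mxE.
  by move=> u; exact: cvg_id.
have cH : continuous (fun p : I * I => H (pt p.1, p.2)).
  apply: (cts_comp _ (@cts_fun _ _ H)); apply: cts_pair; last exact: cts_snd.
  exact: (cts_comp (@cts_fst _ _) cpt).
pose A : set I := [set u | u = clamp 0 \/ u = clamp 1].
have ptA u : A u -> cube_boundary (pt u).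
  move=> [|] ->; exists ord0; rewrite mxE; [left|right];
  by rewrite clampE ?lexx ?ler01.
have ca : continuous (fun u => loop_fun a (pt u)).
  exact: (cts_comp cpt (@cts_fun _ _ (loop_fun a))).
have [|||||g [cg gH gA]] :=
    @sqrt_homotopy R I A (fun p => H (pt p.1, p.2)) (fun u => loop_fun a (pt u)).
- exact: compact_unit_interval.
- exact: cH.
- by move=> u s /ptA bu /=; rewrite !Hx.
- exact: ca.
- by move=> u /=; rewrite H0.
have ends u : A u -> g u = cis 0.
  by move=> Au; rewrite gA// loop_boundary//; exact: ptA.
have g0 := ends _ (or_introl erefl); have g1 := ends _ (or_intror erefl).
have gs u : sqc (g u) = sqc (half_turn u).
  rewrite gH /= H1.
  change (sqc (half_turn (pt u ord0 ord0)) = sqc (half_turn u)).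
  by rewrite mxE.
have one_neq : oppc (cis 0) <> cis 0 :> circle.
  by move=> /(congr1 (@cre R)); rewrite cre_oppc !circE; lra.
have [e|e] := sqrt_unique shrink_interval_contraction cg continuous_half_turn gs.
  by apply: one_neq; have := e (clamp 1); rewrite g1 half_turn1.
by apply: one_neq; have := e (clamp 0); rewrite g0 /= half_turn0.
Qed.

Theorem squaring_not_homotopy_equiv : ~ rational_homotopy_equiv R (squaring R).
Proof.
move=> [_ /(_ (cis 0))[[inv _ invK] _]].
have := invK (\pi full_turn); elim/quotW: (inv _) => a.
rewrite pi_map_pi => /eqmodP; apply/negP; exact: full_turn_not_squared.
Qed.

End FundamentalGroup.

Theorem proposition10p14 (R : realType) (LHQ_Top LQ_Top : model_structure) :
  is_LHQ_Top R LHQ_Top -> is_LQ_Top R LQ_Top -> LHQ_Top <> LQ_Top.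
Proof.
move=> [_ wHQ] [_ wQ] e; rewrite -e in wQ.
exact/(@squaring_not_homotopy_equiv R)/wQ/wHQ/squaring_homology_iso.
Qed.
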